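(* Let $G$ be a finitely generated group. Then $G$ is exact if and only if there exists an invariant expectation on $G$.
   Context: $G$ is a discrete group generated by a finite symmetric set $S=S^{-1}$. All Banach spaces are over $\mathbb{R}$. Write $C=\ell_\infty(G)$ with the supremum norm $\|\cdot\|_C$, $1_G\in C$ for the constant function $1$, and let $G$ act on $C$ by $(g*f)(h)=f(g^{-1}h)$. For a function $f:G\to C$ write $f_g=f(g)\in C$, and $\operatorname{supp} f=\{g: f_g\neq 0\}$. The uniform convolution algebra $\ell_u(G)$ is the completion of $C_c(G,C)=\{f:G\to C : \#\operatorname{supp} f<\infty\}$ in the norm $\|f\|_u=\big\|\sum_{g\in G}|f_g|\big\|_C$; its elements are regarded as functions $\xi:G\to C$. $G$ acts on $\ell_u(G)$ by isometries by $(g\star\xi)_h=g*\xi_{g^{-1}h}$ (equivalently, $g\star\xi=\delta_g\star\xi$, where $(\delta_g)_g=1_G$, $(\delta_g)_h=0$ for $h\ne g$, and $(f\star f')_g=\sum_{h}f_h\,(h*f'_{h^{-1}g})$). Exactness: $G$ is exact if for every $\varepsilon>0$ there is $\xi\in\ell_u(G)$ such that (a) $\xi_g=0$ for all but finitely many $g\in G$; (b) $\xi_g\ge 0$ for all $g\in G$ and $\sum_{g\in G}\xi_g=1_G$; (c) $\|\xi-s\star\xi\|_u\le\varepsilon$ for every $s\in S$. Let $\ell_\infty(G,C)=\{f:G\to C:\sup_g\|f_g\|_C<\infty\}$, and let $\mathds{1}_G\in\ell_\infty(G,C)$ be given by $(\mathds{1}_G)_h=1_G$ for all $h\in G$. There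 is a $C$-valued pairing $\langle\xi,f\rangle_C=\sum_{g\in G}\xi_g f_g\in C$ for $\xi\in\ell_u(G)$, $f\in\ell_\infty(G,C)$. For Banach spaces $X,Y$, $\mathcal{L}(X,Y)$ is the Banach space of bounded linear operators. Each $f\in\ell_\infty(G,C)$ is viewed as the operator $\xi\mapsto\langle\xi,f\rangle_C$ in $\mathcal{L}(\ell_u(G),C)$. For any Banach space $X$, $\mathcal{L}(X,C)$ is isometrically isomorphic to $\ell_\infty(G,X^* )$ via $T\mapsto (g\mapsto (x\mapsto T(x)(g)))$, hence is the dual of $\ell_1(G,X)$; the weak-* topology on $\mathcal{L}(X,C)$ is the one coming from this predual. In particular $\mathcal{L}(\mathcal{L}(\ell_u(G),C),C)$ carries this weak-* topology (taking $X=\mathcal{L}(\ell_u(G),C)$). $\ell_u(G)$ is embedded isometrically in $\mathcal{L}(\mathcal{L}(\ell_u(G),C),C)$ by $\xi\mapsto\hat\xi$, $\hat\xi(T)=T(\xi)$. $G$ acts on $\mathcal{L}(\ell_u(G),C)$ by $(g\cdot T)(\xi)=g*(T(g^{-1}\star\xi))$ and on $\mathcal{L}(\mathcal{L}(\ell_u(G),C),C)$ by $(g\bullet\Xi)(T)=g*(\Xi(g^{-1}\cdot T))$. Let $\mathcal{W}_{00}=\{\xi\in\ell_u(G): \#\operatorname{supp}\xi<\infty \text{ and } \langle\xi,\mathds{1}_G\rangle_C=c\,1_G\text{ for some }c\in\mathbb{R}\}$, and let $\mathcal{W}$ be the weak-* closure of $\mathcal{W}_{00}$ (embedded via $\xi\mapsto\hat\xi$)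 in $\mathcal{L}(\mathcal{L}(\ell_u(G),C),C)$. An invariant expectation on $G$ is a bounded linear operator $M:\mathcal{L}(\ell_u(G),C)\to C$ such that (a) $M\in\mathcal{W}$; (b) $M(\mathds{1}_G)=1_G$; (c) $g\bullet M=M$ for every $g\in G$. *)

(* Defs.v *)
From HB Require Import structures.
From mathcomp Require Import all_boot all_order all_algebra.
From mathcomp Require Import all_classical all_reals all_analysis.
From mathcomp Require Import ring lra.

Set Implicit Arguments.
Unset Strict Implicit.
Unset Printing Implicit Defensive.

Import Order.TTheory GRing.Theory Num.Theory.
Import numFieldNormedType.Exports.

Local Open Scope classical_set_scope.
Local Open Scope ring_scope.

Section BoundedFunctions.
Context {R : realType} (I : choiceType) (V : normedModType R).

Definition linf_pred : {pred I -> V} :=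
  fun f => `[< exists M : R, forall i, `|f i| <= M >].

Lemma linf_predP (f : I -> V) :
  reflect (exists M : R, forall i, `|f i| <= M) (f \in linf_pred).
Proof. exact: asboolP. Qed.

Lemma linf_submod_closed : submod_closed linf_pred.
Proof.
split; first by apply/linf_predP; exists 0 => i; rewrite normr0.
move=> a f g /linf_predP[M fM] /linf_predP[N gN]; apply/linf_predP.
exists (`|a| * M + N) => i; rewrite (le_trans (ler_normD _ _))// normrZ.
by rewrite lerD// ler_wpM2l.
Qed.

HB.instance Definition _ := GRing.isSubmodClosed.Build R (I -> V) linf_pred
  linf_submod_closed.

Record linf := Linf { linf_fun :> I -> V ; _ : linf_fun \in linf_pred }.

HB.instance Definition _ := [isSub for linf_fun].
HB.instance Definition _ := [Choice of linf by <:].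
HB.instance Definition _ := [SubChoice_isSubLmodule of linf by <:].

Definition linf_norm (f : linf) : R := sup (range (fun i => `|f i|)).

Lemma linf_has_ub (f : linf) : has_ubound (range (fun i => `|f i|)).
Proof.
case: f => f /= /linf_predP[M fM]; exists M => _ [i _ <-]; exact: fM.
Qed.

Lemma linf_norm_ub (f : linf) i : `|f i| <= linf_norm f.
Proof. by apply: ub_le_sup; [exact: linf_has_ub | exists i]. Qed.

Lemma linf_norm_le (f : linf) (M : R) :
  0 <= M -> (forall i, `|f i| <= M) -> linf_norm f <= M.
Proof.
move=> M0 fM; rewrite /linf_norm.
have [->|/set0P ne] := eqVneq (range (fun i => `|f i|)) set0.
  by rewrite sup0.
by apply: ge_sup => // _ [i _ <-]; exact: fM.
Qed.

Lemma linf_norm_ge0 (f : linf) : 0 <= linf_norm f.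
Proof.
rewrite /linf_norm; have [->|/set0P[_ [i _ _]]] :=
  eqVneq (range (fun i => `|f i|)) set0; first by rewrite sup0.
exact: le_trans (linf_norm_ub f i).
Qed.

Lemma linf_normD (f g : linf) :
  linf_norm (f + g) <= linf_norm f + linf_norm g.
Proof.
apply: linf_norm_le; first by rewrite addr_ge0 ?linf_norm_ge0.
by move=> i; rewrite (le_trans (ler_normD _ _))// lerD ?linf_norm_ub.
Qed.

Lemma linf_normZ (a : R) (f : linf) : linf_norm (a *: f) = `|a| * linf_norm f.
Proof.
have le b (g : linf) : linf_norm (b *: g) <= `|b| * linf_norm g.
  apply: linf_norm_le; first by rewrite mulr_ge0 ?linf_norm_ge0.
  by move=> i; rewrite normrZ ler_wpM2l ?linf_norm_ub.
apply/eqP; rewrite eq_le le /=.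
have [->|a0] := eqVneq a 0; first by rewrite normr0 mul0r linf_norm_ge0.
rewrite -{1}[f](scalerK a0) -ler_pdivlMl ?normr_gt0//.
by rewrite (le_trans (le _ _))// normfV.
Qed.

Lemma linf_norm_eq0 (f : linf) : linf_norm f = 0 -> f = 0.
Proof.
move=> f0; apply/val_inj/funext => i /=; apply/normr0_eq0/eqP.
by rewrite eq_le normr_ge0 andbT -f0 linf_norm_ub.
Qed.

HB.instance Definition _ := Lmodule_isNormed.Build R linf
  linf_normD linf_normZ linf_norm_eq0.

Lemma linf_normE (f : linf) : `|f| = sup (range (fun i => `|f i|)).
Proof. by []. Qed.

End BoundedFunctions.

Arguments linf_pred {R I V} f.

Section BoundedOperators.
Context {R : realType} (X Y : normedModType R).

Definition blin_pred : {pred X -> Y} := fun T =>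
  `[< linear T /\ exists M : R, forall x, `|T x| <= M * `|x| >].

Lemma blin_predP (T : X -> Y) :
  reflect (linear T /\ exists M : R, forall x, `|T x| <= M * `|x|)
          (T \in blin_pred).
Proof. exact: asboolP. Qed.

Lemma blin_submod_closed : submod_closed blin_pred.
Proof.
split.
  apply/blin_predP; split; first by move=> a x y; rewrite scaler0 addr0.
  by exists 0 => x; rewrite mul0r normr0.
move=> a S T /blin_predP[lS [M SM]] /blin_predP[lT [N TN]].
apply/blin_predP; split.
  move=> b x y; have E z : (a *: S + T) z = a *: S z + T z by [].
  by rewrite !E lS lT !scalerDr !scalerA [b * a]mulrC addrACA.
exists (`|a| * M + N) => x; rewrite (le_trans (ler_normD _ _))// normrZ mulrDl.
by rewrite lerD// -mulrA ler_wpM2l.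
Qed.

HB.instance Definition _ := GRing.isSubmodClosed.Build R (X -> Y) blin_pred
  blin_submod_closed.

Record blin := Blin { blin_fun :> X -> Y ; _ : blin_fun \in blin_pred }.

HB.instance Definition _ := [isSub for blin_fun].
HB.instance Definition _ := [Choice of blin by <:].
HB.instance Definition _ := [SubChoice_isSubLmodule of blin by <:].

Lemma blin_linear (T : blin) : linear T.
Proof. by case: T => T /= /blin_predP[]. Qed.

HB.instance Definition _ (T : blin) :=
  GRing.isLinear.Build R X Y *:%R (blin_fun T) (blin_linear T).

Definition blin_norm (T : blin) : R :=
  sup [set `|T x| | x in [set x | `|x| <= 1]].

Lemma blin_has_ub (T : blin) : has_ubound [set `|T x| | x in [set x | `|x| <= 1]].
Proof.
case: T => T /= /blin_predP[lT [M TM]]; exists `|M| => _ [x /= x1 <-].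
rewrite (le_trans (TM x))// (le_trans (ler_norm _))// normrM normr_id.
by rewrite ler_piMr.
Qed.

Lemma blin_norm_ge0 (T : blin) : 0 <= blin_norm T.
Proof.
apply: le_trans (ub_le_sup (blin_has_ub T) _); last first.
  by exists 0 => //=; rewrite normr0.
exact: normr_ge0.
Qed.

Lemma blin_norm_ub (T : blin) x : `|T x| <= blin_norm T * `|x|.
Proof.
have [->|x0] := eqVneq x 0; first by rewrite linear0 !normr0 mulr0.
rewrite -ler_pdivrMr ?normr_gt0// mulrC -[X in X * _]gtr0_norm; last first.
  by rewrite invr_gt0 normr_gt0.
rewrite -normrZ -linearZ; apply: ub_le_sup; first exact: blin_has_ub.
exists (`|x|^-1 *: x) => //=.
by rewrite normrZ gtr0_norm ?invr_gt0 ?normr_gt0// mulVf// normr_eq0.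
Qed.

Lemma blin_norm_le (T : blin) (M : R) :
  0 <= M -> (forall x, `|T x| <= M * `|x|) -> blin_norm T <= M.
Proof.
move=> M0 TM; apply: ge_sup; first by exists `|T 0|, 0 => //=; rewrite normr0.
by move=> _ [x /= x1 <-]; rewrite (le_trans (TM x))// ler_piMr.
Qed.

Lemma blin_normD (S T : blin) : blin_norm (S + T) <= blin_norm S + blin_norm T.
Proof.
apply: blin_norm_le; first by rewrite addr_ge0 ?blin_norm_ge0.
move=> x; rewrite (le_trans (ler_normD _ _))// mulrDl.
by rewrite lerD ?blin_norm_ub.
Qed.

Lemma blin_normZ (a : R) (T : blin) : blin_norm (a *: T) = `|a| * blin_norm T.
Proof.
have le b (S : blin) : blin_norm (b *: S) <= `|b| * blin_norm S.
  apply: blin_norm_le; first by rewrite mulr_ge0 ?blin_norm_ge0.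
  by move=> x; rewrite normrZ -mulrA ler_wpM2l ?blin_norm_ub.
apply/eqP; rewrite eq_le le /=.
have [->|a0] := eqVneq a 0; first by rewrite normr0 mul0r blin_norm_ge0.
rewrite -{1}[T](scalerK a0) -ler_pdivlMl ?normr_gt0//.
by rewrite (le_trans (le _ _))// normfV.
Qed.

Lemma blin_norm_eq0 (T : blin) : blin_norm T = 0 -> T = 0.
Proof.
move=> T0; apply/val_inj/funext => x /=; apply/normr0_eq0/eqP.
by rewrite eq_le normr_ge0 andbT (le_trans (blin_norm_ub T x))// T0 mul0r.
Qed.

HB.instance Definition _ := Lmodule_isNormed.Build R blin
  blin_normD blin_normZ blin_norm_eq0.

End BoundedOperators.

Arguments blin_pred {R X Y} T.

Section RealSums.
Context {R : realType} (I : choiceType).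
Implicit Types f g : I -> R.

(* Unordered sum of an absolutely summable family of reals. *)
Definition rsum f : R :=
  fine (\esum_(i in [set: I]) (EFin \o f)^\+%E i) -
  fine (\esum_(i in [set: I]) (EFin \o f)^\-%E i).

Definition abs_summable f := summable [set: I] (EFin \o f).

Lemma esum_le_bound (f : I -> \bar R) (y : \bar R) :
  (forall i, 0 <= f i)%E ->
  (forall s : seq I, uniq s -> \sum_(i <- s) f i <= y)%E ->
  (\esum_(i in [set: I]) f i <= y)%E.
Proof.
move=> f0 fy; apply: ge_ereal_sup => _ [F [finF _] <-].
rewrite fsbig_finite//=; apply: fy; exact: finmap.fset_uniq.
Qed.

Lemma esum_ge_sum (f : I -> \bar R) (s : seq I) :
  uniq s -> (\sum_(i <- s) f i <= \esum_(i in [set: I]) f i)%E.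
Proof.
move=> us; apply: ereal_sup_ubound; exists [set` s]; last by rewrite -fsbig_seq.
by split=> //; exact: finite_seq.
Qed.

Lemma esumZl (c : R) (f : I -> \bar R) : 0 <= c -> (forall i, 0 <= f i)%E ->
  (\esum_(i in [set: I]) (c%:E * f i) = c%:E * \esum_(i in [set: I]) f i)%E.
Proof.
have le (b : R) (g : I -> \bar R) : 0 <= b -> (forall i, 0 <= g i)%E ->
    (\esum_(i in [set: I]) (b%:E * g i) <= b%:E * \esum_(i in [set: I]) g i)%E.
  move=> b0 g0; apply: esum_le_bound => [i|s us]; first by rewrite mule_ge0.
  by rewrite -ge0_sume_distrr// lee_wpmul2l// esum_ge_sum.
move=> c0 f0; apply/eqP; rewrite eq_le le//=.
have [->|cN0] := eqVneq c 0.
  by rewrite mul0e esum_ge0// => i _; rewrite mul0e.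
have cgt0 : 0 < c by rewrite lt_neqAle eq_sym cN0.
rewrite muleC -lee_pdivlMr// muleC.
have := le c^-1 (fun i => c%:E * f i)%E; rewrite invr_ge0 c0 => /(_ isT) h.
apply: le_trans (h _); last by move=> i; rewrite mule_ge0.
by apply: le_esum => i _; rewrite muleA -EFinM mulVf ?gt_eqF// mul1e.
Qed.

Lemma rsumB_ge0 f g : abs_summable f -> abs_summable g ->
  (forall i, 0 <= f i) -> (forall i, 0 <= g i) ->
  rsum (fun i => f i - g i) =
  fine (\esum_(i in [set: I]) (f i)%:E) - fine (\esum_(i in [set: I]) (g i)%:E).
Proof.
move=> sf sg f0 g0; have := esumB sf sg (fun i _ => f0 i) (fun i _ => g0 i).
have sfg := summableB sf sg.
have fp (h : I -> \bar R) : summable [set: I] h ->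
   (\esum_(i in [set: I]) h^\+ i)%E \is a fin_num.
  move=> /summable_funepos; rewrite summableE; congr (_ \is a fin_num).
  by apply: eq_esum => i _; rewrite gee0_abs ?funepos_ge0.
have fn (h : I -> \bar R) : summable [set: I] h ->
   (\esum_(i in [set: I]) h^\- i)%E \is a fin_num.
  move=> /summable_funeneg; rewrite summableE; congr (_ \is a fin_num).
  by apply: eq_esum => i _; rewrite gee0_abs ?funeneg_ge0.
have f1 h : abs_summable h -> (forall i, 0 <= h i) ->
    (\esum_(i in [set: I]) (h i)%:E)%E \is a fin_num.
  move=> + h0; rewrite /abs_summable summableE; congr (_ \is a fin_num).
  by apply: eq_esum => i _ /=; rewrite ger0_norm.
by move=> /(congr1 fine); rewrite !fineB ?fp ?fn ?f1.
Qed.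

Let S f : R := fine (\esum_(i in [set: I]) (f i)%:E).

Let S_fin f : abs_summable f -> (forall i, 0 <= f i) ->
  (\esum_(i in [set: I]) (f i)%:E)%E \is a fin_num.
Proof.
move=> + f0; rewrite /abs_summable summableE; congr (_ \is a fin_num).
by apply: eq_esum => i _ /=; rewrite ger0_norm.
Qed.

Let S_lin (a : R) f g : 0 <= a -> abs_summable f -> abs_summable g ->
  (forall i, 0 <= f i) -> (forall i, 0 <= g i) ->
  S (fun i => a * f i + g i) = a * S f + S g.
Proof.
move=> a0 sf sg f0 g0; rewrite /S.
have -> : (\esum_(i in [set: I]) (a * f i + g i)%:E =
    a%:E * (\esum_(i in [set: I]) (f i)%:E) +
    (\esum_(i in [set: I]) (g i)%:E))%E; last first.
  by rewrite fineD ?fin_numM ?S_fin// fineM ?S_fin.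
rewrite -esumZl//.
rewrite -esumD => [|i _|i _]; last 2 first.
- by rewrite -EFinM lee_fin mulr_ge0.
- by rewrite lee_fin.
by apply: eq_esum => i _; rewrite EFinD EFinM.
Qed.

Lemma abs_summable_le f (g : I -> R) :
  (forall i, `|f i| <= `|g i|) -> abs_summable g -> abs_summable f.
Proof.
move=> fg; rewrite /abs_summable /summable; apply: le_lt_trans.
by apply: le_esum => i _ /=; rewrite lee_fin.
Qed.

Lemma abs_summable_lin (a : R) f g : abs_summable f -> abs_summable g ->
  abs_summable (fun i => a * f i + g i).
Proof.
move=> sf sg; rewrite /abs_summable.
have -> : EFin \o (fun i => a * f i + g i) =
   ((EFin \o (fun i => a * f i)%R) \+ (EFin \o g))%E by [].
apply: summableD => //; rewrite /summable.
have -> : (\esum_(i in [set: I]) `|(EFin \o (fun i => (a * f i)%R)) i| =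
    `|a|%:E * \esum_(i in [set: I]) `|(EFin \o f) i|)%E.
  rewrite -esumZl//; apply: eq_esum => i _ /=.
  by rewrite normrM EFinM.
by rewrite lte_mul_pinfty// ltW.
Qed.

Let P f i : R := Num.max (f i) 0.
Let N f i : R := Num.max (- f i) 0.

Let P_ge0 f i : 0 <= P f i. Proof. by rewrite /P le_max lexx orbT. Qed.
Let N_ge0 f i : 0 <= N f i. Proof. by rewrite /N le_max lexx orbT. Qed.
Let P_le f i : P f i <= `|f i|.
Proof. by rewrite /P ge_max ler_norm normr_ge0. Qed.
Let N_le f i : N f i <= `|f i|.
Proof. by rewrite /N ge_max -normrN ler_norm normr_ge0. Qed.
Let PNE f i : f i = P f i - N f i.
Proof.
rewrite /P /N; have [f0|f0] := leP 0 (f i).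
  by rewrite max_r ?subr0// oppr_le0.
by rewrite max_l ?sub0r ?opprK// oppr_ge0 ltW.
Qed.
Let P_sum f : abs_summable f -> abs_summable (P f).
Proof. by apply: abs_summable_le => i; rewrite ger0_norm ?P_le. Qed.
Let N_sum f : abs_summable f -> abs_summable (N f).
Proof. by apply: abs_summable_le => i; rewrite ger0_norm ?N_le. Qed.

Let rsumE f : rsum f = S (P f) - S (N f).
Proof.
rewrite /rsum /S; congr (fine _ - fine _); apply: eq_esum => i _.
  by rewrite funeposE /P /= EFin_max.
by rewrite funenegE /N /= EFin_max.
Qed.

Lemma rsum_lin (a : R) f g : abs_summable f -> abs_summable g ->
  rsum (fun i => a * f i + g i) = a * rsum f + rsum g.
Proof.
move=> sf sg; rewrite [in RHS]rsumE [rsum g]rsumE.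
have [a0|a0] := leP 0 a.
  rewrite mulrBr addrACA -opprD -!S_lin//; do ?[exact: P_sum|exact: N_sum].
  rewrite -rsumB_ge0; last 4 first.
  - by apply: abs_summable_lin; [exact: P_sum|exact: P_sum].
  - by apply: abs_summable_lin; [exact: N_sum|exact: N_sum].
  - by move=> i; rewrite addr_ge0 ?mulr_ge0.
  - by move=> i; rewrite addr_ge0 ?mulr_ge0.
  congr rsum; apply/funext => i.
  transitivity (a * (P f i - N f i) + (P g i - N g i)); [by rewrite -!PNE|ring].
have a0' : 0 <= - a by rewrite oppr_ge0 ltW.
rewrite -[a in RHS]opprK mulNr mulrBr opprB addrACA -opprD.
rewrite -!S_lin//; do ?[exact: P_sum|exact: N_sum].
rewrite -rsumB_ge0; last 4 first.
- by apply: abs_summable_lin; [exact: N_sum|exact: P_sum].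
- by apply: abs_summable_lin; [exact: P_sum|exact: N_sum].
- by move=> i; rewrite addr_ge0 ?mulr_ge0.
- by move=> i; rewrite addr_ge0 ?mulr_ge0.
congr rsum; apply/funext => i.
transitivity (a * (P f i - N f i) + (P g i - N g i)); [by rewrite -!PNE|ring].
Qed.

Lemma rsum_norm_le f (M : R) :
  (\esum_(i in [set: I]) `|f i|%:E <= M%:E)%E -> `|rsum f| <= M.
Proof.
move=> fM; have sf : abs_summable f.
  exact: le_lt_trans fM (ltry _).
have le h : (forall i, 0 <= h i <= `|f i|) -> 0 <= S h <= M.
  move=> hf; have h0 i : 0 <= h i by have /andP[] := hf i.
  have sh : abs_summable h.
    by apply: abs_summable_le sf => i; rewrite ger0_norm//; have /andP[] := hf i.
  rewrite -!lee_fin /S fineK ?S_fin//; apply/andP; split.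
    by apply: esum_ge0 => i _; rewrite lee_fin.
  apply: le_trans fM; apply: le_esum => i _; rewrite lee_fin.
  by have /andP[] := hf i.
have /andP[p0 pM] := le (P f) (fun i => introT andP (conj (P_ge0 f i) (P_le f i))).
have /andP[n0 nM] := le (N f) (fun i => introT andP (conj (N_ge0 f i) (N_le f i))).
by rewrite rsumE ler_norml; apply/andP; split; lra.
Qed.

End RealSums.

Section UniformConvolutionAlgebra.
Context {R : realType} {G : groupType}.

Notation C := (linf G R).

Definition unorm (xi : G -> C) : \bar R :=
  ereal_sup (range (fun h : G => \esum_(g in [set: G]) `|xi g h|%:E)%E).

Lemma unorm_ub (xi : G -> C) h :
  (\esum_(g in [set: G]) `|xi g h|%:E <= unorm xi)%E.
Proof. by apply: ereal_sup_ubound; exists h. Qed.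

Lemma unorm_le (xi : G -> C) (y : \bar R) :
  (forall h, \esum_(g in [set: G]) `|xi g h|%:E <= y)%E -> (unorm xi <= y)%E.
Proof. by move=> xiy; apply: ge_ereal_sup => _ [h _ <-]. Qed.

Lemma unorm_ge0 (xi : G -> C) : (0 <= unorm xi)%E.
Proof.
by apply: le_trans (unorm_ub xi 1%g); apply: esum_ge0 => g _; rewrite lee_fin.
Qed.

Lemma unormD (xi eta : G -> C) : (unorm (xi + eta)%R <= unorm xi + unorm eta)%E.
Proof.
apply: unorm_le => h; apply: le_trans (leeD (unorm_ub xi h) (unorm_ub eta h)).
rewrite -esumD//.
by apply: le_esum => g _; rewrite -EFinD lee_fin; exact: ler_normD.
Qed.

Lemma unormZ (a : R) (xi : G -> C) : (unorm (a *: xi)%R <= `|a|%:E * unorm xi)%E.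
Proof.
apply: unorm_le => h.
apply: (@le_trans _ _ (`|a|%:E * \esum_(g in [set: G]) `|xi g h|%:E)%E).
  rewrite -esumZl//; apply: le_esum => g _.
  by rewrite -EFinM lee_fin -normrM.
by rewrite lee_wpmul2l ?unorm_ub// lee_fin.
Qed.

Lemma unorm_fin_supp (f : G -> C) :
  finite_set [set g | f g != 0] -> (unorm f < +oo)%E.
Proof.
move=> finf; set A := [set g | f g != 0].
apply: (@le_lt_trans _ _ (\sum_(g \in A) `|f g|%:E)%E); last first.
  by rewrite fsumEFin// ltry.
apply: unorm_le => h; rewrite -esum_fset//.
rewrite [leRHS]esum_mkcond; apply: le_esum => g _.
case: ifPn => [_|]; first by rewrite lee_fin; exact: linf_norm_ub.
by rewrite notin_setE /A /= => /negP; rewrite negbK => /eqP ->; rewrite normr0.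
Qed.

(* The completion of the finitely supported functions for [unorm], realised as
   their closure inside the Banach space of all [xi : G -> C] such that
   [unorm xi < +oo]. *)
Definition lu_pred : {pred G -> C} := fun xi => `[< forall e : R, 0 < e ->
  exists2 f : G -> C, finite_set [set g | f g != 0] &
    (unorm (xi - f)%R <= e%:E)%E >].

Lemma lu_predP (xi : G -> C) : reflect (forall e : R, 0 < e ->
  exists2 f : G -> C, finite_set [set g | f g != 0] &
    (unorm (xi - f)%R <= e%:E)%E) (xi \in lu_pred).
Proof. exact: asboolP. Qed.

Lemma fin_supp_lu (f : G -> C) :
  finite_set [set g | f g != 0] -> f \in lu_pred.
Proof.
move=> finf; apply/lu_predP => e e0; exists f => //; rewrite subrr.
apply: unorm_le => h; rewrite esum1 ?lee_fin ?ltW// => g _.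
by rewrite normr0.
Qed.

Lemma lu_submod_closed : submod_closed lu_pred.
Proof.
split; first by apply: fin_supp_lu; rewrite (_ : [set _ | _] = set0)//;
  apply/seteqP; split => g //=; rewrite eqxx.
move=> a x y /lu_predP hx /lu_predP hy; apply/lu_predP => e e0.
have a0 : 0 < `|a| + 1 by rewrite ltr_wpDl.
have [f finf xf] := hx (e / 2 / (`|a| + 1)) (divr_gt0 (divr_gt0 e0 (ltr0Sn _ 1)) a0).
have [k fink yk] := hy (e / 2) (divr_gt0 e0 (ltr0Sn _ 1)).
exists (a *: f + k).
  apply: (@sub_finite_set _ _ ([set g | f g != 0] `|` [set g | k g != 0])).
    move=> g /= ; have [f0|f0] := eqVneq (f g) 0; last by left.
    have [k0|k0] := eqVneq (k g) 0; last by right.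
    have -> : (a *: f + k) g = a *: f g + k g by [].
    by rewrite f0 k0 scaler0 addr0 eqxx.
  by rewrite finite_setU.
rewrite opprD addrACA -scalerBr.
apply: (le_trans (unormD _ _)); rewrite [e in leRHS](splitr e) EFinD.
apply: leeD => //; apply: (le_trans (unormZ _ _)).
apply: (@le_trans _ _ (`|a|%:E * (e / 2 / (`|a| + 1))%:E)%E).
  by rewrite lee_wpmul2l// lee_fin.
rewrite -EFinM lee_fin mulrCA ger_pMr ?divr_gt0//.
by rewrite ler_pdivrMr// mul1r lerDl.
Qed.

HB.instance Definition _ := GRing.isSubmodClosed.Build R (G -> C) lu_pred
  lu_submod_closed.

Record lu := Lu { lu_fun :> G -> C ; _ : lu_fun \in lu_pred }.

HB.instance Definition _ := [isSub for lu_fun].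
HB.instance Definition _ := [Choice of lu by <:].
HB.instance Definition _ := [SubChoice_isSubLmodule of lu by <:].

Lemma unorm_fin_num (xi : lu) : unorm xi \is a fin_num.
Proof.
case: xi => xi /= /lu_predP/(_ _ ltr01)[f finf xf].
rewrite ge0_fin_numE ?unorm_ge0// -[xi](subrK f).
apply: le_lt_trans (unormD _ _) _; apply: lte_add_pinfty.
  exact: le_lt_trans xf (ltry _).
exact: unorm_fin_supp.
Qed.

Definition lu_norm (xi : lu) : R := fine (unorm xi).

Lemma lu_normK (xi : lu) : (lu_norm xi)%:E = unorm xi.
Proof. by rewrite fineK ?unorm_fin_num. Qed.

Lemma lu_norm_ge0 (xi : lu) : 0 <= lu_norm xi.
Proof. by rewrite -lee_fin lu_normK unorm_ge0. Qed.

Lemma lu_normD (xi eta : lu) : lu_norm (xi + eta) <= lu_norm xi + lu_norm eta.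
Proof. by rewrite -lee_fin EFinD !lu_normK; exact: unormD. Qed.

Lemma lu_normZ (a : R) (xi : lu) : lu_norm (a *: xi) = `|a| * lu_norm xi.
Proof.
have le b (y : lu) : lu_norm (b *: y) <= `|b| * lu_norm y.
  by rewrite -lee_fin EFinM !lu_normK; exact: unormZ.
apply/eqP; rewrite eq_le le /=.
have [->|a0] := eqVneq a 0; first by rewrite normr0 mul0r lu_norm_ge0.
rewrite -{1}[xi](scalerK a0) -ler_pdivlMl ?normr_gt0//.
by rewrite (le_trans (le _ _))// normfV.
Qed.

Lemma lu_norm_eq0 (xi : lu) : lu_norm xi = 0 -> xi = 0.
Proof.
move=> xi0; apply/val_inj/funext => g /=; apply/val_inj/funext => h /=.
apply/normr0_eq0/eqP; rewrite eq_le normr_ge0 andbT -lee_fin.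
rewrite -[X in (_ <= X%:E)%E]xi0 lu_normK.
apply: le_trans (unorm_ub xi h).
apply: le_trans (@esum_ge_sum _ _ _ [:: g] isT).
by rewrite big_seq1.
Qed.

HB.instance Definition _ := Lmodule_isNormed.Build R lu
  lu_normD lu_normZ lu_norm_eq0.

End UniformConvolutionAlgebra.

Arguments lu_pred {R G} xi.
Arguments lu R G : clear implicits.

Section Actions.
Context {R : realType} {G : groupType}.

Notation C := (linf G R).
Notation lu := (lu R G).

Lemma actC_subproof (g : G) (f : C) : (fun h => f (g^-1 * h)%g) \in linf_pred.
Proof. by apply/linf_predP; exists `|f| => h; exact: linf_norm_ub. Qed.

Definition actC (g : G) (f : C) : C := Linf (actC_subproof g f).

Lemma actC_linear g : linear (actC g).
Proof. by move=> a f k; apply/val_inj/funext. Qed.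

Lemma actC_norm_le g f : `|actC g f| <= `|f|.
Proof. by apply: linf_norm_le => // h; exact: (linf_norm_ub f (g^-1 * h)%g). Qed.

Let actlu_fun (g : G) (xi : G -> C) (h : G) : C := actC g (xi (g^-1 * h)%g).

Let unorm_actlu (g : G) (xi : G -> C) : (unorm (actlu_fun g xi) <= unorm xi)%E.
Proof.
apply: unorm_le => h; apply: le_trans (unorm_ub xi (g^-1 * h)%g).
apply: esum_le_bound => [k|s us]; first by rewrite lee_fin.
rewrite /actlu_fun /=.
have -> : (\sum_(k <- s) `|xi (g^-1 * k)%g (g^-1 * h)%g|%:E =
    \sum_(k <- map (fun k => g^-1 * k)%g s) `|xi k (g^-1 * h)%g|%:E)%E.
  by rewrite big_map.
by apply: esum_ge_sum; rewrite map_inj_uniq//; exact: mulgI.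
Qed.

Lemma actlu_subproof (g : G) (xi : lu) :
  (fun h => actC g (xi (g^-1 * h)%g)) \in lu_pred.
Proof.
case: xi => xi /= /lu_predP hxi; apply/lu_predP => e e0.
have [f finf xf] := hxi e e0; exists (actlu_fun g f).
  apply: (@sub_finite_set _ _ ((fun k => g * k)%g @` [set k | f k != 0])).
    move=> k /= fk; exists (g^-1 * k)%g; last by rewrite mulgA mulgV mul1g.
    apply: contra_neq fk => fk0; rewrite /actlu_fun fk0.
    by apply/val_inj/funext.
  exact: finite_image.
apply: le_trans xf; apply: le_trans (unorm_actlu g _).
by apply: unorm_le => h; exact: unorm_ub.
Qed.

Definition actlu (g : G) (xi : lu) : lu := Lu (actlu_subproof g xi).

Lemma actlu_linear g : linear (actlu g).
Proof. by move=> a x y; apply/val_inj/funext => h; exact: actC_linear. Qed.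

Lemma actlu_norm_le g xi : `|actlu g xi| <= `|xi|.
Proof. by rewrite -lee_fin !lu_normK; exact: unorm_actlu. Qed.

Lemma oneC_subproof : (fun _ : G => 1 : R) \in linf_pred.
Proof. by apply/linf_predP; exists 1 => h; rewrite normr1. Qed.

Definition oneC : C := Linf oneC_subproof.

Lemma one_linf_subproof : (fun _ : G => oneC) \in linf_pred.
Proof. by apply/linf_predP; exists `|oneC|. Qed.

Definition one_linf : linf G C := Linf one_linf_subproof.

Lemma lu_abs_summable (xi : lu) h : abs_summable (fun g => xi g h).
Proof.
apply: le_lt_trans (unorm_ub xi h) _.
by rewrite -lu_normK ltry.
Qed.

Lemma pairing_esum_le (xi : lu) (f : linf G C) h :
  (\esum_(g in [set: G]) `|xi g h * f g h|%:E <= (`|f| * `|xi|)%:E)%E.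
Proof.
apply: (@le_trans _ _ (`|f|%:E * \esum_(g in [set: G]) `|xi g h|%:E)%E).
  rewrite -esumZl//; apply: le_esum => g _; rewrite -EFinM lee_fin normrM mulrC.
  rewrite ler_wpM2r//; apply: le_trans (linf_norm_ub f g).
  exact: linf_norm_ub (f g) h.
rewrite EFinM lee_wpmul2l// ?lee_fin//.
by rewrite [X in (_ <= X)%E]lu_normK unorm_ub.
Qed.

Lemma pairing_subproof (xi : lu) (f : linf G C) :
  (fun h => rsum (fun g => xi g h * f g h)) \in linf_pred.
Proof.
apply/linf_predP; exists (`|f| * `|xi|) => h.
exact: rsum_norm_le (pairing_esum_le xi f h).
Qed.

(* The sum is computed pointwise on [G]; for [xi] in [lu] it also converges in
   the norm of [C]. *)
Definition pairing (xi : lu) (f : linf G C) : C := Linf (pairing_subproof xi f).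

Lemma pairing_op_subproof (f : linf G C) : (pairing^~ f) \in blin_pred.
Proof.
apply/blin_predP; split.
  move=> a x y; apply/val_inj/funext => h /=.
  have sm z : abs_summable (fun g => lu_fun z g h * f g h).
    exact: le_lt_trans (pairing_esum_le z f h) (ltry _).
  rewrite -[RHS]rsum_lin//; congr rsum; apply/funext => g.
  by rewrite mulrA -mulrDl.
exists `|f| => xi; apply: linf_norm_le; first by rewrite mulr_ge0.
by move=> h; exact: rsum_norm_le (pairing_esum_le xi f h).
Qed.

Definition pairing_op (f : linf G C) : blin lu C := Blin (pairing_op_subproof f).

Lemma actT_subproof (g : G) (T : blin lu C) :
  (fun xi => actC g (T (actlu g^-1%g xi))) \in blin_pred.
Proof.
apply/blin_predP; split.
  by move=> a x y; rewrite actlu_linear linearP actC_linear.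
exists `|T| => xi; apply: le_trans (actC_norm_le _ _) _.
apply: le_trans (blin_norm_ub _ _) _.
by apply: ler_wpM2l; [exact: blin_norm_ge0|exact: actlu_norm_le].
Qed.

Definition actT (g : G) (T : blin lu C) : blin lu C := Blin (actT_subproof g T).

Lemma actT_linear g : linear (actT g).
Proof. by move=> a S T; apply/val_inj/funext => xi; exact: actC_linear. Qed.

Lemma actT_norm_le g T : `|actT g T| <= `|T|.
Proof.
apply: blin_norm_le => // xi; apply: le_trans (actC_norm_le _ _) _.
apply: le_trans (blin_norm_ub _ _) _.
by apply: ler_wpM2l; [exact: blin_norm_ge0|exact: actlu_norm_le].
Qed.

Lemma actM_subproof (g : G) (Xi : blin (blin lu C) C) :
  (fun T => actC g (Xi (actT g^-1%g T))) \in blin_pred.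
Proof.
apply/blin_predP; split.
  by move=> a x y; rewrite actT_linear linearP actC_linear.
exists `|Xi| => T; apply: le_trans (actC_norm_le _ _) _.
apply: le_trans (blin_norm_ub _ _) _.
by apply: ler_wpM2l; [exact: blin_norm_ge0|exact: actT_norm_le].
Qed.

Definition actM (g : G) (Xi : blin (blin lu C) C) : blin (blin lu C) C :=
  Blin (actM_subproof g Xi).

Lemma hat_subproof (xi : lu) : (fun T : blin lu C => T xi) \in blin_pred.
Proof.
apply/blin_predP; split; first by [].
by exists `|xi| => T; rewrite mulrC; exact: blin_norm_ub.
Qed.

Definition hat (xi : lu) : blin (blin lu C) C := Blin (hat_subproof xi).

End Actions.

Section WeakStarTopology.
Context {R : realType} {G : groupType} (X : normedModType R).

Record ell1 := Ell1 {
  ell1_fun :> G -> X ;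
  _ : summable [set: G] (fun g => `|ell1_fun g|%:E)
}.

HB.instance Definition _ := gen_eqMixin ell1.
HB.instance Definition _ := gen_choiceMixin ell1.

(* The duality between [L(X, C) = linf(G, X^* )] and its predual [l1(G, X)]. *)
Definition predual_pairing (T : blin X (linf G R)) (u : ell1) : R :=
  rsum (fun g => T (u g) g).

Definition weak_star : Type := initial_topology
  (predual_pairing : blin X (linf G R) -> {ptws ell1 -> R}).

HB.instance Definition _ := Topological.copy weak_star (initial_topology
  (predual_pairing : blin X (linf G R) -> {ptws ell1 -> R})).

End WeakStarTopology.

Arguments weak_star {R} G X.

Section InvariantExpectations.
Context (R : realType) (G : groupType).

Notation C := (linf G R).
Notation lu := (lu R G).

Definition W00 : set lu := [set xi : lu | finite_set [set g | xi g != 0] /\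
  exists c : R, pairing xi one_linf = c *: oneC].

Definition W : set (blin (blin lu C) C) :=
  @closure (weak_star G (blin lu C)) (hat @` W00).

Record invariant_expectation (M : blin (blin lu C) C) : Prop := {
  ie_W : W M ;
  ie_one : M (pairing_op one_linf) = oneC ;
  ie_inv : forall g : G, actM g M = M
}.

Definition exact_group (S : set G) : Prop :=
  forall e : R, 0 < e -> exists xi : lu,
    [/\ finite_set [set g | xi g != 0],
        (forall g h, 0 <= xi g h),
        \sum_(g \in [set: G]) xi g = oneC &
        forall s, S s -> `|xi - actlu s xi| <= e].

End InvariantExpectations.

Definition subgroup_generated (G : groupType) (S : set G) : set G :=
  smallest [set H : set G | group_closed (mem H)] S.

(* Main.v *)
(** Exactness provides finitely supported means [xi_n] with
    [`|xi_n - s * xi_n| <= 1/(n+1)] for [s] in [S].  Their limit along a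
    non-principal ultrafilter, [M T h = lim T xi_n h], is an invariant
    expectation: invariance holds for [S], hence for the group it generates.

    Conversely let [M] be an invariant expectation, and suppose that no [xi] in
    [W00] with sum [1] is moved by less than [e] by all [s] in [S].  Then the
    sum [c xi] of [xi] in [W00] is bounded by [sup_s `|xi - s * xi| / e], and
    Hahn-Banach yields bounded functionals [phi_s] on [lu] with
    [c xi = \sum_s phi_s (xi - s * xi)] on [W00].  The operators
    [T_s = phi_s(_) 1_G] take constant values; by weak-* closedness so does
    [M T_s], and invariance of [M] gives [M (T_s - s^-1 . T_s) = 0].  But
    [\sum_s (T_s - s^-1 . T_s)] and pairing with [1] agree on [W00], hence [M]
    takes the same value, [1], on both: a contradiction.  So there are almost
    invariant [xi] with sum [1], and [`|xi| / \sum_g `|xi g|] is a mean that is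
    moved at most twice as much. *)
Require Import Defs.
From mathcomp Require Import all_boot all_order all_algebra.
From mathcomp Require Import all_classical all_reals all_analysis.
From mathcomp Require Import ring lra.

Set Implicit Arguments.
Unset Strict Implicit.
Unset Printing Implicit Defensive.

Import Order.TTheory GRing.Theory Num.Theory.
Import numFieldNormedType.Exports.

Local Open Scope classical_set_scope.
Local Open Scope ring_scope.

(** * The Hahn-Banach theorem *)

Section HahnBanach.
Context {R : realType} {V : lmodType R}.
Implicit Types p q : V -> R.

(** Homogeneity is asked for as an inequality only: for [t > 0] the reverse one follows by applying
    it with [t^-1] to [t *: x]. *)
Definition sublinear p := (forall x y, p (x + y) <= p x + p y) /\
  (forall t x, 0 <= t -> p (t *: x) <= t * p x).

Lemma sublinear0 p : sublinear p -> p 0 = 0.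
Proof.
move=> [pD pZ]; apply/eqP; rewrite eq_le; apply/andP; split.
  by have := pZ 0 0 (lexx _); rewrite scale0r mul0r.
by have := pD 0 0; rewrite addr0; lra.
Qed.

Lemma sublinear_opp p x : sublinear p -> - p (- x) <= p x.
Proof.
by move=> sp; have := sp.1 x (- x); rewrite subrr sublinear0//; lra.
Qed.

(** Infimal convolution of [p] with a cone of constraints: when [(0, 0)] is in [K], a linear
    functional [phi] below [cone_inf p K] satisfies both [phi <= p] and [phi (- k.1) <= k.2] for all
    [k] in [K]. *)
Definition cone_inf p (K : set (V * R)) (x : V) : R :=
  inf [set p (x + k.1) + k.2 | k in K].

Section ConeInf.
Context (p : V -> R) (K : set (V * R)).
Hypotheses (sp : sublinear p) (K0 : K (0, 0)).
Hypothesis KD : forall k l, K k -> K l -> K (k.1 + l.1, k.2 + l.2).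
Hypothesis KZ : forall t k, 0 <= t -> K k -> K (t *: k.1, t * k.2).
Hypothesis pK : forall k, K k -> 0 <= p k.1 + k.2.

(** The lower bound is [- p (- x)]: subadditivity gives [p k.1 <= p (x + k.1) + p (- x)], and [pK]
    bounds [p k.1] below by [- k.2]. *)
Lemma cone_inf_has_inf x : has_inf [set p (x + k.1) + k.2 | k in K].
Proof.
split; first by exists (p (x + 0) + 0), (0, 0).
exists (- p (- x)) => _ [k Kk <-]; have := pK Kk.
by have := sp.1 (x + k.1) (- x); rewrite addrAC subrr add0r; lra.
Qed.

Lemma cone_inf_le x k : K k -> cone_inf p K x <= p (x + k.1) + k.2.
Proof. by move=> Kk; apply: ge_inf; [case: (cone_inf_has_inf x) | exists k]. Qed.

Lemma le_cone_inf x y :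
  (forall k, K k -> y <= p (x + k.1) + k.2) -> y <= cone_inf p K x.
Proof.
move=> h; apply: lb_le_inf; first by case: (cone_inf_has_inf x).
by move=> _ [k Kk <-]; exact: h.
Qed.

Lemma cone_inf_le_id x : cone_inf p K x <= p x.
Proof. by have := cone_inf_le x K0; rewrite /= !addr0. Qed.

Lemma cone_inf_sublinear : sublinear (cone_inf p K).
Proof.
split=> [x y|t x].
  rewrite -lerBlDr; apply: le_cone_inf => k Kk.
  rewrite lerBlDr -lerBlDl; apply: le_cone_inf => l Kl.
  have := cone_inf_le (x + y) (KD Kk Kl).
  by have := sp.1 (x + k.1) (y + l.1); rewrite /= addrACA; lra.
rewrite le_eqVlt => /predU1P[<-|t0].
  by rewrite scale0r mul0r -(sublinear0 sp) cone_inf_le_id.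
rewrite mulrC -ler_pdivrMr//; apply: le_cone_inf => k Kk.
rewrite ler_pdivrMr// mulrC mulrDr.
have := cone_inf_le (t *: x) (KZ (ltW t0) Kk).
by have := sp.2 t (x + k.1) (ltW t0); rewrite /= scalerDr; lra.
Qed.

End ConeInf.

Lemma minimal_sublinear_odd p x : sublinear p ->
  (forall q, sublinear q -> (forall y, q y <= p y) -> forall y, p y <= q y) ->
  p (- x) = - p x.
Proof.
move=> sp minp; apply/eqP; rewrite eq_le; apply/andP; split; last first.
  by rewrite lerNl sublinear_opp.
(* Otherwise the infimum of [p (y + t *: x) - t * p x] over [t >= 0] would be a
   smaller sublinear functional. *)
pose K := [set (t *: x, - (t * p x)) | t in [set t : R | 0 <= t]].
have K0 : K (0, 0) by exists 0; rewrite //= scale0r mul0r oppr0.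
have KD k l : K k -> K l -> K (k.1 + l.1, k.2 + l.2).
  move=> [t /= t0 <-] [u /= u0 <-] /=; exists (t + u); first exact: addr_ge0.
  by rewrite scalerDl mulrDl opprD.
have KZ t k : 0 <= t -> K k -> K (t *: k.1, t * k.2).
  move=> t0 [u /= u0 <-] /=; exists (t * u); first exact: mulr_ge0.
  by rewrite scalerA mulrN mulrA.
have pK k : K k -> 0 <= p k.1 + k.2.
  move=> [t /= t0 <-] /=; rewrite subr_ge0.
  move: t0; rewrite le_eqVlt => /predU1P[<-|t0].
    by rewrite mul0r scale0r sublinear0.
  have := sp.2 t^-1 (t *: x); rewrite invr_ge0 (ltW t0) => /(_ isT).
  by rewrite scalerA mulVf ?gt_eqF// scale1r ler_pdivlMl.
apply: le_trans (minp _ (cone_inf_sublinear sp K0 KD KZ pK) _ _) _.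
  by move=> y; exact: cone_inf_le_id.
(* The member [t = 1] of the ray bounds the infimum at [- x] by [p 0 - p x = - p x]. *)
have /(cone_inf_le sp K0 pK (- x)) : K (x, - p x).
  by exists 1; rewrite //= ?ler01// scale1r mul1r.
by rewrite /= addNr sublinear0// add0r.
Qed.

(** For odd [p], the sublinearity inequalities at [- x] and [- y] are the reversed inequalities at
    [x] and [y]. *)
Lemma odd_sublinear_linear p : sublinear p -> (forall x, p (- x) = - p x) ->
  forall a x y, p (a *: x + y) = a * p x + p y.
Proof.
move=> sp odd.
have pD x y : p (x + y) = p x + p y.
  apply/eqP; rewrite eq_le sp.1 /=.
  by have := sp.1 (- x) (- y); rewrite -opprD !odd; lra.
have pZ t x : 0 <= t -> p (t *: x) = t * p x.
  move=> t0; apply/eqP; rewrite eq_le sp.2//=.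
  by have := sp.2 t (- x) t0; rewrite scalerN !odd mulrN lerN2.
move=> a x y; rewrite pD; congr (_ + _).
have [a0|a0] := leP 0 a; first exact: pZ.
have := pZ (- a) x; rewrite oppr_ge0 (ltW a0) => /(_ isT).
by rewrite scaleNr odd mulNr => /oppr_inj.
Qed.

(* A minimal sublinear functional below [p] is odd, hence linear. *)
Lemma linear_le_sublinear p : sublinear p ->
  exists2 phi : V -> R, (forall a x y, phi (a *: x + y) = a * phi x + phi y) &
    forall x, phi x <= p x.
Proof.
move=> sp; pose T := {q : V -> R | sublinear q /\ forall x, q x <= p x}.
(* The order is reversed: maximal elements are minimal functionals, and a nonempty chain is bounded
   by its pointwise infimum, which is finite because every [q x] is at least [- p (- x)]. *)
pose ord (q r : T) : bool := `[< forall x, sval r x <= sval q x >].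
have p0 : T by exists p.
have [q minq] : exists q : {classic T}, premaximal ord q.
  apply: (ZL_preorder (p0 : {classic T})).
  - by move=> q; apply/asboolP.
  - move=> q r s /asboolP h /asboolP k; apply/asboolP => x.
    exact: le_trans (k x) (h x).
  move=> A totA; have [[q0 Aq0]|A0] := pselect (A !=set0); last first.
    by exists p0 => q Aq; case: A0; exists q.
  pose B x := [set sval q x | q in A].
  have B_inf x : has_inf (B x).
    split; first by exists (sval q0 x), q0.
    exists (- p (- x)) => _ [q _ <-]; case: q => q [sq qp] /=.
    by apply: le_trans (sublinear_opp x sq); rewrite lerN2.
  have leB x (q : T) : A q -> inf (B x) <= sval q x.
    by move=> Aq; apply: ge_inf; [case: (B_inf x) | exists q].
  have geB x y : (forall q : T, A q -> y <= sval q x) -> y <= inf (B x).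
    move=> h; apply: lb_le_inf; first by case: (B_inf x).
    by move=> _ [q Aq <-]; exact: h.
  have sB : sublinear (fun x => inf (B x)).
    split=> [x y|t x t0].
      rewrite -lerBlDr; apply: (geB) => q Aq.
      rewrite lerBlDr -lerBlDl; apply: (geB) => r Ar.
      rewrite lerBlDr.
      (* Members of a chain are comparable, and the smaller of [q] and [r] takes at [x + y] a value
         at most [q x + r y]. *)
      have [/asboolP h|/asboolP h] := totA _ _ Aq Ar.
        apply: (le_trans (leB (x + y) r Ar)).
        by apply: le_trans ((svalP r).1.1 x y) _; rewrite addrC lerD2l.
      apply: (le_trans (leB (x + y) q Aq)).
      by apply: le_trans ((svalP q).1.1 x y) _; rewrite addrC lerD2r.
    move: t0; rewrite le_eqVlt => /predU1P[<-|t0].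
      rewrite mul0r scale0r; apply: le_trans (leB 0 q0 Aq0) _.
      by rewrite sublinear0//; exact: (svalP q0).1.
    rewrite mulrC -ler_pdivrMr//; apply: (geB) => q Aq.
    rewrite ler_pdivrMr// mulrC; apply: le_trans (leB _ q Aq) _.
    by apply: (svalP q).1.2; exact: ltW.
  have Bp x : inf (B x) <= p x by apply: le_trans (leB x q0 Aq0) _; exact: (svalP q0).2.
  exists (exist _ (fun x => inf (B x)) (conj sB Bp)) => q Aq.
  by apply/asboolP => x /=; exact: leB.
case: q minq => q [sq qp] minq; exists q => //.
apply: odd_sublinear_linear => // x; apply: minimal_sublinear_odd => // r sr rq.
have rp y : r y <= p y by exact: le_trans (rq y) (qp y).
have := minq (exist _ r (conj sr rp)) => /(_ _)/asboolP; apply.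
by apply/asboolP.
Qed.

(** Extends [D u |-> c u] from the image of [E]; [D] may have a kernel, on which [cp] forces [c] to
    vanish within [E]. With [K] the set of pairs [(D u, - c u)], a functional below [cone_inf p K]
    satisfies [phi (- D u) <= - c u]. As [K] is a subspace, this also holds for [- u], which gives
    equality. *)
Lemma hahn_banach_pullback (U : lmodType R) (E : {pred U}) (D : U -> V)
    (c : U -> R) p :
  submod_closed E -> linear D -> (forall a u v, c (a *: u + v) = a * c u + c v) ->
  sublinear p -> (forall u, u \in E -> c u <= p (D u)) ->
  exists phi : V -> R, [/\ forall a x y, phi (a *: x + y) = a * phi x + phi y,
    forall x, phi x <= p x & forall u, u \in E -> phi (D u) = c u].
Proof.
move=> [E0 EL] linD linc sp cp.
have D0 : D 0 = 0.
  by have := linD (-1) 0 0; rewrite !scaleN1r !addNr.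
have c0 : c 0 = 0.
  by have := linc (-1) 0 0; rewrite scaleN1r addNr mulN1r addNr.
have DN u : D (- u) = - D u.
  by have := linD (-1) u 0; rewrite !scaleN1r D0 !addr0.
have cN u : c (- u) = - c u.
  by have := linc (-1) u 0; rewrite scaleN1r c0 mulN1r !addr0.
have EN u : u \in E -> - u \in E.
  by move=> Eu; have := EL (-1) u 0 Eu E0; rewrite scaleN1r addr0.
pose K := [set (D u, - c u) | u in [set u | u \in E]].
have K0 : K (0, 0) by exists 0; rewrite //= D0 c0 oppr0.
have KD k l : K k -> K l -> K (k.1 + l.1, k.2 + l.2).
  move=> [u /= Eu <-] [v /= Ev <-] /=; exists (1 *: u + v); first exact: EL.
  by rewrite linD linc scale1r mul1r opprD.
have KZ t k : 0 <= t -> K k -> K (t *: k.1, t * k.2).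
  move=> _ [u /= Eu <-] /=; exists (t *: u + 0); first exact: EL.
  by rewrite linD linc D0 c0 !addr0 mulrN.
have pK k : K k -> 0 <= p k.1 + k.2.
  by move=> [u /= Eu <-] /=; rewrite subr_ge0; exact: cp.
have [phi linphi phile] := linear_le_sublinear (cone_inf_sublinear sp K0 KD KZ pK).
exists phi; split=> // [x|].
  exact: le_trans (phile x) (cone_inf_le_id sp K0 pK x).
have le u : u \in E -> phi (- D u) <= - c u.
  move=> Eu; apply: le_trans (phile _) _.
  have /(cone_inf_le sp K0 pK (- D u)) : K (D u, - c u) by exists u.
  by rewrite /= addNr sublinear0// add0r.
have phi0 : phi 0 = 0.
  by have := linphi (-1) 0 0; rewrite scaleN1r addNr mulN1r addNr.
have phiN x : phi (- x) = - phi x.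
  by have := linphi (-1) x 0; rewrite scaleN1r phi0 mulN1r !addr0.
move=> u Eu; apply/eqP; rewrite eq_le; apply/andP; split.
  by have := le _ (EN _ Eu); rewrite DN cN !opprK.
by have := le _ Eu; rewrite phiN lerN2.
Qed.

End HahnBanach.

(** * Finite sums and the uniform convolution algebra *)

Section FiniteSums.
Context {R : realType} {I : choiceType}.

Lemma esum_seq (s : seq I) (f : I -> \bar R) : uniq s ->
  (forall i, 0 <= f i)%E -> (forall i, i \notin s -> f i = 0%E) ->
  (\esum_(i in [set: I]) f i = \sum_(i <- s) f i)%E.
Proof.
move=> us f0 fs; apply/eqP; rewrite eq_le esum_ge_sum// andbT.
apply: esum_le_bound => // t ut.
rewrite (bigID (mem s))/= [X in (_ + X)%E]big1 => [|i /fs//]; rewrite adde0.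
rewrite -big_filter [leRHS](bigID (mem t))/= -[X in (_ <= X + _)%E]big_filter.
rewrite (perm_big [seq i <- s | i \in t]) /=.
  by rewrite leeDl//; apply: sume_ge0.
apply: uniq_perm; rewrite ?filter_uniq// => i.
by rewrite !mem_filter andbC.
Qed.

Lemma rsum_seq (s : seq I) (f : I -> R) : uniq s ->
  (forall i, i \notin s -> f i = 0) -> rsum f = \sum_(i <- s) f i.
Proof.
move=> us fs; rewrite /rsum !(esum_seq us)//; last 2 first.
- by move=> i /fs fi; rewrite funenegE /= fi oppr0 maxxx.
- by move=> i /fs fi; rewrite funeposE /= fi maxxx.
have -> : (\sum_(i <- s) (EFin \o f)^\+ i = (\sum_(i <- s) Num.max (f i) 0)%:E)%E.
  by rewrite -sumEFin; apply: eq_bigr => i _; rewrite funeposE EFin_max.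
have -> : (\sum_(i <- s) (EFin \o f)^\- i = (\sum_(i <- s) Num.max (- f i) 0)%:E)%E.
  by rewrite -sumEFin; apply: eq_bigr => i _; rewrite funenegE EFin_max.
rewrite /= -sumrB; apply: eq_bigr => i _.
have [fi|fi] := leP 0 (f i).
  by rewrite max_r ?subr0// oppr_le0.
by rewrite max_l ?sub0r ?opprK// oppr_ge0 ltW.
Qed.

(** Write [a i / A - b i / B] as [(a i - b i) / A - (b i / B) * ((A - B) / A)]. Since [A >= 1], the
    weights [b i / B] sum to [1] and [A - B] is itself at most [e] in absolute value, each term
    contributes at most [e]. *)
Lemma normalize_dist_le (s : seq I) (a b : I -> R) (e : R) :
  (forall i, 0 <= a i) -> (forall i, 0 <= b i) ->
  1 <= \sum_(i <- s) a i -> 1 <= \sum_(i <- s) b i ->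
  \sum_(i <- s) `|a i - b i| <= e ->
  \sum_(i <- s) `|a i / (\sum_(j <- s) a j) - b i / (\sum_(j <- s) b j)| <= 2 * e.
Proof.
move=> a0 b0; set A := \sum_(i <- s) a i; set B := \sum_(i <- s) b i.
move=> A1 B1 abe.
have A0 : 0 < A by rewrite (lt_le_trans ltr01).
have B0 : 0 < B by rewrite (lt_le_trans ltr01).
have AB : `|A - B| <= e.
  by apply: le_trans abe; rewrite /A /B -sumrB; exact: ler_norm_sum.
have e0 : 0 <= e by exact: le_trans AB.
have le i : `|a i / A - b i / B| <= `|a i - b i| + b i / B * `|A - B|.
  have -> : a i / A - b i / B = (a i - b i) / A - b i / B * ((A - B) / A).
    by field; rewrite !gt_eqF.
  have V1 : `|A^-1| <= 1 by rewrite gtr0_norm ?invr_gt0// invf_le1.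
  apply: le_trans (ler_normB _ _) _; rewrite !normrM lerD//.
    by rewrite ler_piMr.
  rewrite (ger0_norm (b0 i)) [`|B^-1|]gtr0_norm ?invr_gt0//.
  by apply: ler_wpM2l; [rewrite divr_ge0 ?(ltW B0)|rewrite ler_piMr].
apply: le_trans (ler_sum _ (fun i _ => le i)) _.
rewrite big_split/= -2!mulr_suml divff ?gt_eqF// mul1r.
by rewrite mulr_natl mulr2n lerD.
Qed.

End FiniteSums.

Section UniformAlgebraNorm.
Context {R : realType} {G : groupType}.
Notation C := (linf G R).
Notation lu := (lu R G).
Implicit Types (xi : lu) (s : seq G).

Lemma linf_sumE (J : choiceType) (V : normedModType R) (I : Type) (s : seq I)
    (f : I -> linf J V) j :
  (\sum_(i <- s) f i) j = \sum_(i <- s) f i j.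
Proof. by apply: (big_morph (fun f : linf J V => f j)). Qed.

Lemma lu_norm_le xi (M : R) :
  (forall h s, uniq s -> \sum_(g <- s) `|xi g h| <= M) -> `|xi| <= M.
Proof.
move=> xiM; rewrite -lee_fin [X in (X <= _)%E]lu_normK.
apply: unorm_le => h; apply: esum_le_bound => [g|s us]; first by rewrite lee_fin.
by rewrite sumEFin lee_fin xiM.
Qed.

Lemma lu_norm_ge xi h s : uniq s -> \sum_(g <- s) `|xi g h| <= `|xi|.
Proof.
move=> us; rewrite -lee_fin -sumEFin [X in (_ <= X)%E]lu_normK.
by apply: le_trans (unorm_ub xi h); exact: esum_ge_sum.
Qed.

Lemma finite_supp_seq (f : G -> C) : finite_set [set g | f g != 0] ->
  exists2 s, uniq s & forall g, g \notin s -> f g = 0.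
Proof.
move=> /finite_seqP[s fs]; exists (undup s); first exact: undup_uniq.
move=> g; rewrite mem_undup; apply: contraNeq => fg.
by have : [set g | f g != 0] g by []; rewrite fs.
Qed.

Lemma finite_supp_of_seq (f : G -> C) s : (forall g, g \notin s -> f g = 0) ->
  finite_set [set g | f g != 0].
Proof.
move=> fs; apply: (@sub_finite_set _ _ [set` s]); last exact: finite_seq.
by move=> g /=; apply: contraR => /fs/eqP.
Qed.

Lemma pairing_one_seq xi s h : uniq s -> (forall g, g \notin s -> xi g = 0) ->
  pairing xi one_linf h = \sum_(g <- s) xi g h.
Proof.
move=> us xis /=; rewrite (rsum_seq us) => [|g /xis->]; last by rewrite mul0r.
by apply: eq_bigr => g _; rewrite mulr1.
Qed.

Lemma fsum_linf_seq (f : G -> C) s h : uniq s -> (forall g, g \notin s -> f g = 0) ->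
  (\sum_(g \in [set: G]) f g) h = \sum_(g <- s) f g h.
Proof.
move=> us fs; rewrite (fsbigE _ _ us)//= => [|g _ /fs//].
by rewrite -linf_sumE; congr (linf_fun _ h); apply: eq_bigl => g; rewrite in_setT.
Qed.

(** * Turning an element of sum one into a nonnegative one *)

Section Normalization.
Context (xi : lu) (s : seq G).
Hypotheses (us : uniq s) (xis : forall g, g \notin s -> xi g = 0).
Hypothesis xi1 : forall h, \sum_(g <- s) xi g h = 1.

Let N h := \sum_(g <- s) `|xi g h|.

Let N1 h : 1 <= N h.
Proof. by rewrite -(xi1 h); apply: ler_sum => g _; exact: ler_norm. Qed.

Let N0 h : 0 < N h. Proof. exact: lt_le_trans (N1 h). Qed.

Lemma lu_normalize_subproof g : (fun h => `|xi g h| / N h) \in linf_pred.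
Proof.
apply/linf_predP; exists `|xi g| => h.
rewrite ger0_norm ?divr_ge0 ?(ltW (N0 h))// ler_pdivrMr//.
apply: le_trans (linf_norm_ub (xi g) h) _.
by rewrite ler_peMr ?N1 ?linf_norm_ge0.
Qed.

Let eta_fun g : C := Linf (lu_normalize_subproof g).

Let eta_supp g : g \notin s -> eta_fun g = 0.
Proof.
move=> gs; apply/val_inj/funext => h /=.
by rewrite (xis gs) normr0 mul0r.
Qed.

(** Here [eta g h] is [|xi g h| / N h], and [N h >= 1] because the values of [xi] at [h] sum to [1].
    The displacement is estimated at each [h] separately by [normalize_dist_le]. *)
Lemma lu_normalize : exists eta : lu, [/\ finite_set [set g | eta g != 0],
  (forall g h, 0 <= eta g h), \sum_(g \in [set: G]) eta g = oneC &
  forall k, `|eta - actlu k eta| <= 2 * `|xi - actlu k xi|].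
Proof.
pose eta : lu := Lu (fin_supp_lu (finite_supp_of_seq eta_supp)).
exists eta; split; first exact: finite_supp_of_seq eta_supp.
- by move=> g h /=; rewrite divr_ge0 ?(ltW (N0 h)).
- apply/val_inj/funext => h /=; rewrite [LHS](fsum_linf_seq h us eta_supp) /=.
  by rewrite -mulr_suml divff ?(lt0r_neq0 (N0 h)).
move=> k; apply: lu_norm_le => h t ut.
(* [u] contains [t] and the supports of [xi] and of its translate by [k], so sums over [u] are the
   full normalising sums and dominate sums over [t]. *)
pose u := undup (t ++ s ++ map (fun g => k * g)%g s).
have uu : uniq u by exact: undup_uniq.
pose a g := `|xi g h|; pose b g := `|xi (k^-1 * g)%g (k^-1 * h)%g|.
have sumE (r : seq G) (f : G -> R) : uniq r -> {subset r <= u} ->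
    (forall g, g \notin r -> f g = 0) -> \sum_(g <- u) f g = \sum_(g <- r) f g.
  move=> ur ru fr; rewrite (bigID (mem r))/= [X in _ + X]big1 => [|g /fr//].
  rewrite addr0 -big_filter; apply: perm_big; apply: uniq_perm => //.
    exact: filter_uniq.
  by move=> g; rewrite mem_filter andbC; apply/andP/idP => [[]|gr]//; rewrite ru.
have aE : \sum_(g <- u) a g = N h.
  apply: sumE => // [g gs|g /xis gs]; last by rewrite /a gs normr0.
  by rewrite mem_undup !mem_cat gs orbT.
(* Translation moves the base point too, so the translate of [eta] is normalised by [N] at
   [k^-1 * h]. *)
have bE : \sum_(g <- u) b g = N (k^-1 * h)%g.
  rewrite (sumE (map (fun g => k * g)%g s)).
  - rewrite big_map; apply: eq_bigr => g _.
    by rewrite /b mulgA mulVg mul1g.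
  - by rewrite map_inj_uniq//; exact: mulgI.
  - by move=> g gs; rewrite mem_undup !mem_cat gs !orbT.
  move=> g gs; rewrite /b xis ?normr0//; apply: contra gs => gs.
  by apply/mapP; exists (k^-1 * g)%g => //; rewrite mulgA mulgV mul1g.
have le : \sum_(g <- u) `|a g - b g| <= `|xi - actlu k xi|.
  apply: le_trans (lu_norm_ge (xi - actlu k xi) h uu).
  by apply: ler_sum => g _; exact: ler_dist_dist.
have := @normalize_dist_le _ _ u a b _ _ _ _ _ le; rewrite aE bE.
move=> /(_ (fun=> normr_ge0 _) (fun=> normr_ge0 _) (N1 _) (N1 _)).
apply: le_trans; rewrite [leRHS](bigID (mem t))/= -[X in _ <= X + _]big_filter.
have -> : \sum_(g <- t) `|(eta - actlu k eta) g h| =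
   \sum_(g <- [seq g <- u | g \in t]) `|a g / N h - b g / N (k^-1 * h)%g|.
  apply: perm_big; apply: uniq_perm => //; first exact: filter_uniq.
  move=> g; rewrite mem_filter mem_undup mem_cat.
  by case: (g \in t).
by rewrite lerDl sumr_ge0.
Qed.

End Normalization.

End UniformAlgebraNorm.

(** * From invariant expectations to exactness *)

Section WeakStarClosure.
Context {R : realType} {G : groupType}.
Notation C := (linf G R).
Notation lu := (lu R G).
Notation op := (blin lu C).

Lemma ell1_delta_subproof (X : normedModType R) (h : G) (x : X) :
  summable [set: G] (fun g => `|if g == h then x else 0|%:E).
Proof.
rewrite /summable (@esum_seq _ _ [:: h])//= ?big_seq1 ?ltry//.
by move=> g; rewrite inE => /negPf ->; rewrite normr0 normr0.
Qed.

(** The point mass in the predual that represents the evaluation [Xi |-> Xi x h]. *)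
Definition ell1_delta (X : normedModType R) (h : G) (x : X) : @ell1 R G X :=
  Ell1 (ell1_delta_subproof h x).

Lemma predual_pairing_delta (X : normedModType R) (Xi : blin X C) h x :
  predual_pairing Xi (ell1_delta h x) = Xi x h.
Proof.
rewrite /predual_pairing (@rsum_seq _ _ [:: h])//= ?big_seq1 ?eqxx//.
by move=> g; rewrite inE => /negPf ->; rewrite linear0.
Qed.

(** Such an evaluation is the coordinate at [ell1_delta h x] of the map defining the initial
    topology. *)
Lemma weak_star_eval_continuous (X : normedModType R) h (x : X) :
  continuous (fun Xi : weak_star G X => (Xi : blin X C) x h : R^o).
Proof.
pose f : weak_star G X -> {ptws (@ell1 R G X) -> R} := @predual_pairing R G X.
have fc : continuous f by exact: initial_continuous.
have -> : (fun Xi : weak_star G X => (Xi : blin X C) x h : R^o) =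
    (fun u : {ptws (@ell1 R G X) -> R} => u (ell1_delta h x)) \o f.
  by apply/funext => Xi /=; rewrite -predual_pairing_delta.
move=> Xi; apply: continuous_comp; first exact: fc.
exact: proj_continuous.
Qed.

(** The set of [Xi] with [Xi T h = Xi T' h'] is weak-* closed and contains the image of [W00]. Two
    operators and two points are allowed, so that it serves both to show that [M T] is constant and
    to compare [M] on two operators. *)
Lemma W_eval_eq (M : blin op C) (T T' : op) h h' : W M ->
  (forall xi, W00 xi -> T xi h = T' xi h') -> M T h = M T' h'.
Proof.
move=> WM TT'; apply/eqP; rewrite -subr_eq0; apply/eqP.
pose f (Xi : weak_star G op) : R^o :=
  ((Xi : blin op C) T h : R^o) - ((Xi : blin op C) T' h' : R^o).
have fc : continuous f.
  move=> Xi; exact: (cvgB (@weak_star_eval_continuous op h T Xi)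
    (@weak_star_eval_continuous op h' T' Xi)).
have clf : closed (f @^-1` [set 0]).
  by apply: closed_comp => [Xi _|]; [exact: fc | exact: closed_eq].
rewrite -[LHS]/(f M).
have sub : hat @` (@W00 R G) `<=` f @^-1` [set 0].
  by move=> _ [xi xiW <-]; rewrite /f /= TT'// subrr.
have := @closure_subset (weak_star G op) _ _ sub M WM.
by rewrite -((closure_id _).1 clf).
Qed.

End WeakStarClosure.

(** * Displacements and almost invariant elements *)

Section ExpectationToExact.
Context {R : realType} {G : groupType}.
Notation C := (linf G R).
Notation lu := (lu R G).
Notation op := (blin lu C).

Lemma actT_invE (g : G) (T : op) (xi : lu) h :
  actT g^-1%g T xi h = T (actlu g xi) (g * h)%g.
Proof. by rewrite /= !invgK. Qed.

(** Invariance turns [M (actT g^-1 T) h] into [M T (g * h)], which equals [M T h] because [M T]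
    inherits constancy from [T]. *)
Lemma expectation_coboundary (M : blin op C) (g : G) (T : op) h :
  invariant_expectation M -> (forall xi h h', T xi h = T xi h') ->
  M (T - actT g^-1%g T) h = 0.
Proof.
move=> [WM _ /(_ g) Minv] Tcst; rewrite linearB /=.
rewrite -[_ h]/(M T h - M (actT g^-1%g T) h).
have -> : M (actT g^-1%g T) h = M T (g * h)%g.
  by rewrite -[in RHS]Minv /= mulgA mulVg mul1g.
by rewrite (W_eval_eq (h' := (g * h)%g) WM (fun xi _ => Tcst xi _ _)) subrr.
Qed.

Lemma linf_if_subproof (V : normedModType R) (P : pred G) (f : G -> V) (B : R) :
  (forall g, `|f g| <= B) -> (fun g => if P g then f g else 0) \in linf_pred.
Proof.
move=> fB; apply/linf_predP; exists B => g.
by case: ifP => // _; rewrite normr0; apply: le_trans (fB g).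
Qed.

Lemma displacement_le (xi : lu) g : `|xi - actlu g xi| <= 2 * `|xi|.
Proof.
apply: le_trans (ler_normB _ _) _.
by rewrite mulr_natl mulr2n lerD// actlu_norm_le.
Qed.

(** The tuple of all [xi - actlu g xi] with [g] in [s], extended by [0] off [s] so that the space of
    tuples is a subspace of [linf G lu] and carries its supremum norm. *)
Definition displacement (s : seq G) (xi : lu) : linf G lu :=
  Linf (linf_if_subproof (mem s) (displacement_le xi)).

(** The coordinate injections, through which a functional on tuples is split into its components. *)
Definition linf_delta (V : normedModType R) (g : G) (x : V) : linf G V :=
  Linf (linf_if_subproof (pred1 g) (fun=> lexx `|x|)).

Lemma linf_delta_linear (V : normedModType R) (g : G) : linear (@linf_delta V g).
Proof.
move=> a x y; apply/val_inj/funext => h /=.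
rewrite -[RHS]/(a *: (if h == g then x else 0) + (if h == g then y else 0)).
by case: ifP => //; rewrite scaler0 addr0.
Qed.

Lemma linf_delta_norm_le (V : normedModType R) (g : G) (x : V) :
  `|linf_delta g x| <= `|x|.
Proof.
by apply: linf_norm_le => // h /=; case: ifP => //; rewrite normr0.
Qed.

Lemma displacement_linear s : linear (displacement s).
Proof.
move=> a x y; apply/val_inj/funext => g /=.
rewrite -[RHS]/(a *: (if g \in s then x - actlu g x else 0) +
  (if g \in s then y - actlu g y else 0)).
case: ifP => _; last by rewrite scaler0 addr0.
by rewrite actlu_linear scalerBr opprD addrACA.
Qed.

Lemma displacementE s xi : uniq s ->
  displacement s xi = \sum_(g <- s) linf_delta g (xi - actlu g xi).
Proof.
move=> us; apply/val_inj/funext => h.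
rewrite [RHS]linf_sumE /=; case: ifPn => hs.
  rewrite (bigD1_seq h)//= eqxx big1 ?addr0// => g gh.
  by rewrite eq_sym (negPf gh).
rewrite big_seq big1// => g gs; case: eqP => // hg.
by rewrite hg gs in hs.
Qed.

Lemma oneC_norm_le : `|oneC : C| <= 1.
Proof. by apply: linf_norm_le => // h; rewrite normr1. Qed.

Lemma scalar_op_subproof (phi : lu -> R) (B : R) :
  (forall a x y, phi (a *: x + y) = a * phi x + phi y) ->
  (forall x, `|phi x| <= B * `|x|) ->
  (fun xi => phi xi *: oneC : C) \in blin_pred.
Proof.
move=> linphi phiB; apply/blin_predP; split.
  by move=> a x y; rewrite linphi scalerDl scalerA.
exists B => x; rewrite normrZ; apply: le_trans (phiB x).
by rewrite ler_piMr// oneC_norm_le.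
Qed.

Lemma W00_submod_closed : submod_closed (mem (@W00 R G)).
Proof.
split.
  rewrite inE; split.
    by apply: (@finite_supp_of_seq _ _ _ [::]).
  by exists 0; rewrite -[LHS]/(pairing_op one_linf 0) linear0 scale0r.
move=> a x y; rewrite !inE => -[/finite_supp_seq[s us xs] [c xc]].
move=> [/finite_supp_seq[t ut yt] [d yd]]; split.
  apply: (@finite_supp_of_seq _ _ _ (s ++ t)) => g.
  rewrite mem_cat negb_or => /andP[gs gt].
  by rewrite -[LHS]/(a *: x g + y g) xs// yt// scaler0 addr0.
exists (a * c + d); rewrite -[LHS]/(pairing_op one_linf (a *: x + y)).
by rewrite linearP /= xc yd scalerDl scalerA.
Qed.

Lemma expectation_almost_invariant (M : blin op C) (s : seq G) (e : R) :
  invariant_expectation M -> uniq s -> 0 < e -> exists xi : lu,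
    [/\ finite_set [set g | xi g != 0], pairing xi one_linf = oneC &
        forall g, g \in s -> `|xi - actlu g xi| <= e].
Proof.
move=> ieM us e0; apply: contrapT => noxi.
(* On [W00] the pairing is a constant function, so its value at [1] is the sum; evaluation keeps [c]
   linear on all of [lu]. *)
pose c (xi : lu) : R := pairing xi one_linf 1%g.
pose p (y : linf G lu) := `|y| / e.
have sp : sublinear p.
  split=> [x y|t x t0]; rewrite /p.
    by rewrite -mulrDl ler_pM2r ?invr_gt0// ler_normD.
  by rewrite normrZ ger0_norm// mulrA.
have linc a u v : c (a *: u + v) = a * c u + c v.
  by rewrite /c -[pairing _ _]/(pairing_op one_linf _) linearP.
(* If this failed, [c xi] would be positive and dividing [xi] by it would give an element of sum [1]
   moved by at most [e], against [noxi]. *)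
have cp xi : xi \in mem (@W00 R G) -> c xi <= p (displacement s xi).
  rewrite inE => -[finxi [d xid]].
  have cd : c xi = d by rewrite /c xid /= -[LHS]/(d * 1) mulr1.
  rewrite cd /p; have [d0|d0] := leP d 0.
    by apply: le_trans d0 _; rewrite divr_ge0// ltW.
  rewrite ler_pdivlMr// leNgt; apply/negP => lt; apply: noxi.
  exists (d^-1 *: xi); split.
  - apply: sub_finite_set finxi => g /=; apply: contra_neq => xig.
    by rewrite -[LHS]/(d^-1 *: xi g) xig scaler0.
  - rewrite -[LHS]/(pairing_op one_linf (d^-1 *: xi)) linearZ /= xid scalerA.
    by rewrite mulVf ?gt_eqF// scale1r.
  move=> g gs; have -> : d^-1 *: xi - actlu g (d^-1 *: xi) =
      d^-1 *: displacement s xi g.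
    rewrite /= gs scalerBr; congr (_ - _).
    by apply/val_inj/funext => h; apply/val_inj/funext.
  rewrite normrZ gtr0_norm ?invr_gt0// ler_pdivrMl//.
  by apply: le_trans (ltW lt); exact: linf_norm_ub.
have [phi [linphi phip phic]] :=
  hahn_banach_pullback W00_submod_closed (displacement_linear s) linc sp cp.
have phi0 : phi 0 = 0.
  by have := linphi (-1) 0 0; rewrite scaleN1r addNr mulN1r addNr.
have phiD x y : phi (x + y) = phi x + phi y.
  by have := linphi 1 x y; rewrite scale1r mul1r.
have phiN x : phi (- x) = - phi x.
  by have := linphi (-1) x 0; rewrite scaleN1r phi0 mulN1r !addr0.
(* As [p] is symmetric, the one-sided bound by [p] at [y] and [- y] bounds the absolute value. *)
have phi_norm y : `|phi y| <= e^-1 * `|y|.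
  rewrite ler_norml [e^-1 * _]mulrC phip andbT lerNl -phiN.
  by apply: le_trans (phip _) _; rewrite /p normrN.
pose phi_ g xi := phi (linf_delta g (xi : lu)).
have linphi_ g a x y : phi_ g (a *: x + y) = a * phi_ g x + phi_ g y.
  by rewrite /phi_ linf_delta_linear linphi.
have phi_B g x : `|phi_ g x| <= e^-1 * `|x|.
  apply: le_trans (phi_norm _) _.
  by rewrite ler_wpM2l ?invr_ge0 ?(ltW e0)// linf_delta_norm_le.
pose T g : op := Blin (scalar_op_subproof (linphi_ g) (phi_B g)).
have Tcst g xi h h' : T g xi h = T g xi h' by [].
pose U := \sum_(g <- s) (T g - actT g^-1%g (T g)).
have MU : M U 1%g = 0.
  rewrite /U linear_sum linf_sumE big1// => g _.
  exact: expectation_coboundary.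
(* On [xi] the summand for [g] is [phi_ g (xi - actlu g xi)]: the values of [T g] are constant, so
   the translation of the base point is not seen. These components add up to
   [phi (displacement s xi) = c xi]. *)
have UE xi : W00 xi -> U xi 1%g = pairing_op one_linf xi 1%g.
  move=> Wxi; rewrite -[RHS]/(c xi) -phic ?inE// displacementE//.
  have -> : U xi = \sum_(g <- s) (T g - actT g^-1%g (T g)) xi.
    by apply: (big_morph (fun f : op => f xi)).
  rewrite linf_sumE (big_morph phi phiD phi0); apply: eq_bigr => g _.
  rewrite -[LHS]/(T g xi 1%g - actT g^-1%g (T g) xi 1%g) actT_invE /=.
  rewrite -[LHS]/(phi_ g xi * 1 - phi_ g (actlu g xi) * 1) !mulr1 addrC.
  have := linphi_ g (-1) (actlu g xi) xi.
  by rewrite mulN1r scaleN1r [- actlu _ _ + _]addrC => <-.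
have := W_eval_eq (ie_W ieM) UE; rewrite MU (ie_one ieM) /= => /eqP.
by rewrite eq_sym oner_eq0.
Qed.

Lemma expectation_exact (M : blin op C) (S : set G) : finite_set S ->
  invariant_expectation M -> exact_group R S.
Proof.
move=> /finite_seqP[s Ss] ieM e e0.
(* The tolerance is [e / 2] because normalisation may double the displacement. *)
have [xi [finxi xi1 xie]] :=
  expectation_almost_invariant ieM (undup_uniq s) (divr_gt0 e0 (ltr0Sn R 1)).
have [t ut xit] := finite_supp_seq finxi.
have xit1 h : \sum_(g <- t) xi g h = 1.
  by rewrite -(pairing_one_seq h ut xit) xi1.
have [eta [fineta eta0 eta1 etaxi]] := lu_normalize ut xit xit1.
exists eta; split=> // g; rewrite Ss /= => gs.
apply: le_trans (etaxi g) _; rewrite mulrC -ler_pdivlMr//.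
by apply: xie; rewrite mem_undup.
Qed.

End ExpectationToExact.

(** * From exactness to invariant expectations *)

Lemma blin_linE (R : realType) (X Y : normedModType R) (a : R) (T T' : blin X Y) x :
  (a *: T + T') x = a *: T x + T' x.
Proof. by []. Qed.

Lemma linf_linE (R : realType) (I : choiceType) (a : R) (f g : linf I R) i :
  (a *: f + g) i = a * f i + g i.
Proof. by []. Qed.

(** * Limits of bounded real families along an ultrafilter *)

Section UltraLimits.
Context {R : realType} {J : Type} (U : set_system J) {UU : UltraFilter U}.

Lemma ultra_cvg_bounded (u : J -> R) (B : R) :
  (forall j, `|u j| <= B) -> cvg (u @ U).
Proof.
move=> uB; have := @segment_compact R (- B) B; rewrite compact_ultra.
(* A set of a finer filter whose preimage is not in [U] has its complement in the image of [U],
   hence in that finer filter, which is then improper. Compactness of the segment applies to this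
   image ultrafilter. *)
have UF : UltraFilter (u @ U).
  split; first exact: fmap_proper_filter.
  move=> F FF UF; apply/seteqP; split=> // A FA.
  have [//|nUA] := in_ultra_setVsetC (u @^-1` A) UU.
  have /UF FnA : (u @ U) (~` A) by [].
  have : F (A `&` ~` A) by exact: filterI.
  by rewrite setICr => /filter_not_empty.
have UB : (u @ U) [set` `[- B, B]].
  by apply: nearW => j /=; rewrite in_itv /= -ler_norml.
move=> /(_ _ UF UB)[l [_ ul]].
by apply/cvg_ex; exists l.
Qed.

End UltraLimits.

(** * Dominated convergence for unordered sums *)

Section DominatedSums.
Context {R : realType} {I : choiceType}.

(** Take [s] with partial sum within [e] of the total: a finite set disjoint from [s] can only add
    what is missing. *)
Lemma summable_tail (b : I -> R) (e : R) : abs_summable b -> 0 < e ->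
  exists2 s : seq I, uniq s &
    forall t, uniq t -> {in t, forall i, i \notin s} -> \sum_(i <- t) `|b i| <= e.
Proof.
move=> sb e0.
have fin : (\esum_(i in [set: I]) `|(EFin \o b) i|)%E \is a fin_num.
  by move: sb; rewrite /abs_summable summableE.
have /(ub_ereal_sup_adherent e0)[_ [F [finF _] <-] lt] := fin.
move: lt; rewrite fsbig_finite//=; set s := finmap.enum_fset _ => lt.
have us : uniq s by exact: finmap.fset_uniq.
exists s => // t ut ts.
have := @esum_ge_sum _ _ (fun i => `|(EFin \o b) i|)%E (s ++ t).
rewrite cat_uniq us ut andbT => /(_ _)/le_trans/(_ (lexx _)) h.
move: h lt; rewrite -/(esum _ _) -(fineK fin) big_cat/= !sumEFin -EFinD.
rewrite -EFinB !(lee_fin, lte_fin) => h lt.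
have {}h : \sum_(i <- s) `|b i| + \sum_(i <- t) `|b i| <=
    fine (\esum_(i in [set: I]) `|(EFin \o b) i|)%E.
  by apply: h; apply/hasPn => i /ts.
by lra.
Qed.

Lemma rsum_dominated_cvg (J : Type) (F : set_system J) (FF : Filter F)
    (x : J -> I -> R) (y b : I -> R) : abs_summable b ->
  (forall j i, `|x j i| <= `|b i|) -> (forall i, `|y i| <= `|b i|) ->
  (forall i, x j i @[j --> F] --> y i) ->
  rsum (x j) @[j --> F] --> rsum y.
Proof.
move=> sb xb yb xy; apply/cvgrPdist_le => e e0.
(* Off [s] the difference is dominated by [2 * |b i|], so a tail of [e / 4] costs [e / 2]; the other
   half is spent on the finite set [s]. *)
have e4 : 0 < e / 4 by rewrite divr_gt0.
have [s us tail] := summable_tail sb e4.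
have : \forall j \near F, \sum_(i <- s) `|y i - x j i| <= e / 2.
  have : \sum_(i <- s) `|y i - x j i| @[j --> F] --> \sum_(i <- s) `|y i - y i|.
    apply: cvg_big => [|i _]; first exact: add_continuous.
    by apply: cvg_norm; apply: cvgB; [exact: cvg_cst|exact: xy].
  rewrite big1 => [|i _]; last by rewrite subrr normr0.
  move/cvgrPdist_le => /(_ (e / 2)); rewrite divr_gt0// => /(_ isT).
  by apply: filterS => j; rewrite sub0r normrN; apply: le_trans; exact: ler_norm.
apply: filterS => j sj.
have sx : abs_summable (x j) by exact: abs_summable_le sb.
have sy : abs_summable y by exact: abs_summable_le sb.
have -> : rsum y - rsum (x j) = rsum (fun i => -1 * x j i + y i).
  by rewrite rsum_lin// mulN1r addrC.
apply: rsum_norm_le; apply: esum_le_bound => [i|t ut]; first by rewrite lee_fin.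
rewrite sumEFin lee_fin (bigID (mem s))/= [leRHS]splitr; apply: lerD.
  apply: le_trans sj; rewrite -big_filter [leRHS](bigID (mem t))/=.
  rewrite -[X in _ <= X + _]big_filter (perm_big [seq i <- s | i \in t]) /=.
    rewrite ler_wpDr ?sumr_ge0//.
    by under eq_bigr do rewrite mulN1r addrC.
  by apply: uniq_perm; rewrite ?filter_uniq// => i; rewrite !mem_filter andbC.
rewrite -big_filter; set r := seq.filter _ t.
have : \sum_(i <- r) `|b i| <= e / 4.
  apply: tail; first exact: filter_uniq.
  by move=> i; rewrite mem_filter => /andP[].
have : \sum_(i <- r) `|-1 * x j i + y i| <= \sum_(i <- r) 2 * `|b i|.
  apply: ler_sum => i _; rewrite mulN1r addrC (le_trans (ler_normB _ _))//.
  by rewrite mulr_natl mulr2n lerD.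
by rewrite -mulr_sumr; lra.
Qed.

End DominatedSums.

Section ExactToExpectation.
Context {R : realType} {G : groupType}.
Notation C := (linf G R).
Notation lu := (lu R G).
Notation op := (blin lu C).

Lemma actM1 (Xi : blin op C) : actM 1%g Xi = Xi.
Proof.
apply/val_inj/funext => T /=; apply/val_inj/funext => h /=.
rewrite invg1 mul1g; congr (linf_fun (Xi _) h).
apply/val_inj/funext => xi /=; apply/val_inj/funext => k /=.
rewrite !invg1 mul1g; congr (linf_fun (T _) k).
apply/val_inj/funext => g /=; apply/val_inj/funext => l /=.
by rewrite invg1 !mul1g.
Qed.

Lemma actM_mul g k (Xi : blin op C) : actM (g * k)%g Xi = actM g (actM k Xi).
Proof.
apply/val_inj/funext => T /=; apply/val_inj/funext => h /=.
rewrite invgM mulgA; congr (linf_fun (Xi _) _).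
apply/val_inj/funext => xi /=; apply/val_inj/funext => l /=.
rewrite !invgM !invgK mulgA; congr (linf_fun (T _) _).
apply/val_inj/funext => m /=; apply/val_inj/funext => n /=.
by rewrite !invgM !mulgA.
Qed.

(** The stabiliser of [Xi] is a subgroup. *)
Lemma actM_generated (S : set G) (Xi : blin op C) :
  (forall s, S s -> actM s Xi = Xi) ->
  forall g, subgroup_generated S g -> actM g Xi = Xi.
Proof.
move=> SXi; apply: smallest_sub => //; split.
  by rewrite inE; exact: actM1.
move=> g k; rewrite !inE /= => gXi kXi.
have kVXi : actM k^-1%g Xi = Xi by rewrite -{1}kXi -actM_mul mulVg actM1.
by rewrite actM_mul kVXi.
Qed.

Lemma ptws_cvg (I J : Type) (F : set_system J) {FF : Filter F}
    (f : J -> I -> R) (l : I -> R) :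
  (forall i, f j i @[j --> F] --> l i) -> {ptws, f @ F --> l}.
Proof.
move=> fl; apply/cvg_sup => i A [_ [[V oV <-] Vl] VA].
have /fl : nbhs (l i) V by exact: open_nbhs_nbhs.
by move=> FV; apply: (@filterS J F FF _ _ _ FV) => j Vf; exact: VA.
Qed.

(** * The operator defined by the limit of elements of the unit ball *)

Section MeanLimit.
Context (U : set_system nat) {UU : UltraFilter U} (xi : nat -> lu).
Hypothesis xi_norm : forall n, `|xi n| <= 1.

Let eval_le (T : op) h n : `|T (xi n) h| <= `|T|.
Proof.
apply: le_trans (linf_norm_ub _ h) _; apply: le_trans (blin_norm_ub T _) _.
by rewrite ler_piMr// blin_norm_ge0.
Qed.

Let limM (T : op) h : R := lim (T (xi n) h @[n --> U]).

Let limM_cvg (T : op) h : T (xi n) h @[n --> U] --> limM T h.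
Proof. exact: ultra_cvg_bounded (eval_le T h). Qed.

Let limM_le (T : op) h : `|limM T h| <= `|T|.
Proof.
have c : `|T (xi n) h| @[n --> U] --> `|limM T h| by apply: cvg_norm; exact: limM_cvg.
apply: (cvgr_to_le c).
by apply: nearW => n; exact: eval_le.
Qed.

Let limM_lin a (T T' : op) h : limM (a *: T + T') h = a * limM T h + limM T' h.
Proof.
have c : a * T (xi n) h + T' (xi n) h @[n --> U] --> a * limM T h + limM T' h.
  by apply: cvgD; [apply: cvgM; [exact: cvg_cst|]|]; exact: limM_cvg.
have E : (fun n => a * T (xi n) h + T' (xi n) h) = fun n => (a *: T + T') (xi n) h.
  by apply/funext => n; rewrite blin_linE linf_linE.
rewrite E in c.
exact: (cvg_lim (@Rhausdorff R) c).
Qed.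

Lemma mean_limit_linf_subproof (T : op) : limM T \in linf_pred.
Proof. by apply/linf_predP; exists `|T|. Qed.

Lemma mean_limit_blin_subproof :
  (fun T : op => Linf (mean_limit_linf_subproof T)) \in blin_pred.
Proof.
apply/blin_predP; split.
  by move=> a T T'; apply/val_inj/funext => h /=; rewrite limM_lin.
exists 1 => T; rewrite mul1r.
by apply: linf_norm_le => [|h]; [exact: blin_norm_ge0 | exact: limM_le].
Qed.

Definition mean_limit : blin op C := Blin mean_limit_blin_subproof.

Lemma mean_limit_cvg (T : op) h : T (xi n) h @[n --> U] --> mean_limit T h.
Proof. exact: limM_cvg. Qed.

(** Paired with [u] in the predual, [hat (xi n)] gives a sum with terms bounded by the summable
    [|u g|]. Dominated convergence along [U] therefore makes [hat (xi n)] converge weak-* to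
    [mean_limit]. *)
Lemma mean_limit_W : (forall n, W00 (xi n)) -> W mean_limit.
Proof.
move=> xiW; pose f : weak_star G op -> {ptws (@ell1 R G op) -> R} :=
  @predual_pairing R G op.
have cvg_f : {ptws, (fun n => f (hat (xi n))) @ U --> f mean_limit}.
  apply: ptws_cvg => u.
  apply: (@rsum_dominated_cvg _ _ _ U _ _ _ (fun g => `|u g|)).
  - case: u => u; rewrite /abs_summable /summable /=.
    by under eq_esum do rewrite /= normr_id.
  - by move=> n g /=; rewrite normr_id; exact: eval_le.
  - by move=> g /=; rewrite normr_id; exact: limM_le.
  - by move=> g; exact: mean_limit_cvg.
move=> B [_ [[V oV <-] VM] VB].
have /cvg_f : nbhs (f mean_limit) V by exact: open_nbhs_nbhs.
move=> UV; have [n Vn] := @filter_ex nat U _ _ UV.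
exists (hat (xi n)); split; first by exists (xi n).
exact: VB.
Qed.

(** The difference of the two sides at [T] and [h] is the limit of [- T (xi n - actlu g (xi n)) h],
    which is at most [|T|] times the displacement. *)
Lemma mean_limit_inv g : `|xi n - actlu g (xi n)| @[n --> U] --> (0 : R) ->
  actM g mean_limit = mean_limit.
Proof.
move=> xig; apply/val_inj/funext => T; apply/val_inj/funext => h.
rewrite -[LHS]/(mean_limit (actT g^-1%g T) (g^-1 * h)%g) -[RHS]/(mean_limit T h).
apply/eqP; rewrite -subr_eq0; apply/eqP.
pose d n := actT g^-1%g T (xi n) (g^-1 * h)%g - T (xi n) h.
have dE n : d n = - (T (xi n - actlu g (xi n)) h).
  rewrite /d actT_invE mulgA mulgV mul1g linearB /=.
  by rewrite -[X in _ = - X]/(T (xi n) h - T (actlu g (xi n)) h) opprB.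
have dM : d n @[n --> U] -->
    mean_limit (actT g^-1%g T) (g^-1 * h)%g - mean_limit T h.
  by apply: cvgB; exact: mean_limit_cvg.
have d0 : d n @[n --> U] --> (0 : R).
  apply: norm_cvg0; apply: (squeeze_cvgr (f := fun=> 0)
    (h := fun n => `|T| * `|xi n - actlu g (xi n)|)).
  - apply: nearW => n; rewrite normr_ge0 dE normrN andTb.
    by apply: le_trans (linf_norm_ub _ h) _; exact: (blin_norm_ub T).
  - exact: cvg_cst.
  - by rewrite -[X in _ --> X](mulr0 `|T|); apply: cvgM => //; exact: cvg_cst.
by rewrite -(cvg_lim _ dM)// (cvg_lim _ d0).
Qed.

End MeanLimit.

Lemma mean_norm_le (xi : lu) s : uniq s -> (forall g, g \notin s -> xi g = 0) ->
  (forall g h, 0 <= xi g h) -> (forall h, \sum_(g <- s) xi g h = 1) -> `|xi| <= 1.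
Proof.
move=> us xis xi0 xi1; apply: lu_norm_le => h t ut.
rewrite -(xi1 h) [leRHS](bigID (mem t))/= (bigID (mem s))/=.
rewrite [X in _ + X <= _]big1 => [|g /xis->]; last by rewrite normr0.
rewrite addr0 -big_filter -[X in _ <= X + _]big_filter.
rewrite (perm_big [seq g <- s | g \in t]) /=.
  under eq_bigr do rewrite ger0_norm//.
  by rewrite lerDl sumr_ge0.
by apply: uniq_perm; rewrite ?filter_uniq// => g; rewrite !mem_filter andbC.
Qed.

Lemma exact_expectation (S : set G) : subgroup_generated S = [set: G] ->
  exact_group R S -> exists M : blin op C, invariant_expectation M.
Proof.
move=> genS exS.
have [xi xiP] : exists xi : nat -> lu, forall n,
    [/\ finite_set [set g | xi n g != 0], (forall g h, 0 <= xi n g h),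
        \sum_(g \in [set: G]) xi n g = oneC &
        forall s, S s -> `|xi n - actlu s (xi n)| <= n.+1%:R^-1].
  have h n : 0 < (n.+1%:R^-1 : R) by rewrite invr_gt0.
  have [xi xiP] := boolp.choice (fun n => exS _ (h n)).
  by exists xi.
have xi_one n : pairing (xi n) one_linf = oneC.
  have [/finite_supp_seq[s us xs] _ x1 _] := xiP n.
  apply/val_inj/funext => h; rewrite [LHS](pairing_one_seq h us xs).
  by rewrite -(fsum_linf_seq h us xs) x1.
have xi_norm n : `|xi n| <= 1.
  have [/finite_supp_seq[s us xs] x0 x1 _] := xiP n.
  by apply: (mean_norm_le us xs x0) => h; rewrite -(fsum_linf_seq h us xs) x1.
(* [U] refines the filter at infinity, so that the bounds [1 / (n + 1)] still tend to [0] along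
   it. *)
have [U [UU ooU]] := ultraFilterLemma (@eventually_filter : ProperFilter \oo).
exists (mean_limit (U := U) xi_norm); split.
- apply: mean_limit_W => n; have [fin _ _ _] := xiP n; split=> //.
  by exists 1; rewrite scale1r.
- apply/val_inj/funext => h; apply: cvg_lim => //=.
  have -> : (fun n => pairing_op one_linf (xi n) h) = fun=> oneC h.
    by apply/funext => n; rewrite -(xi_one n).
  exact: cvg_cst.
move=> g; apply: (actM_generated (S := S)); last by rewrite genS.
move=> s Ss; apply: mean_limit_inv.
apply: (squeeze_cvgr (f := fun=> 0) (h := fun n : nat => n.+1%:R^-1)).
- by apply: nearW => n; rewrite normr_ge0; have [_ _ _] := xiP n; exact.
- exact: cvg_cst.
exact: cvg_trans (cvg_app _ ooU) (@cvg_harmonic R).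
Qed.

End ExactToExpectation.

Theorem theorem1p1 (R : realType) (G : groupType) (S : set G)
  (finS : finite_set S)
  (symS : forall s, S s -> S (s^-1)%g)
  (genS : subgroup_generated S = [set: G]) :
  exact_group R S <->
  exists M : blin (blin (lu R G) (linf G R)) (linf G R),
    invariant_expectation M.
Proof.
split; first exact: exact_expectation.
by move=> [M]; exact: expectation_exact.
Qed.
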